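(* Let rearrangement invariant spaces $X_0$ and $X_1$ be two interpolation spaces between $L_\infty$ and $G$. If $$\Bigl\|\sum_{k=1}^\infty a_k r_k\Bigr\|_{X_0}\asymp\Bigl\|\sum_{k=1}^\infty a_k r_k\Bigr\|_{X_1}$$ (with constants independent of $a=(a_k)_{k=1}^\infty\in l_2$), then $X_0=X_1$ and the norms of $X_0$ and $X_1$ are equivalent.
   Context: All function spaces consist of measurable functions on $[0,1]$ with Lebesgue measure; $r_k(t)=\operatorname{sign}\sin(2^{k-1}\pi t)$, $k=1,2,\dots$, are the Rademacher functions. A Banach space $X$ of measurable functions on $[0,1]$ is rearrangement invariant if $x^*(t)\le y^*(t)$ for $t\in[0,1]$ and $y\in X$ imply $x\in X$ and $\|x\|\le\|y\|$, where $z^*$ is the nonincreasing rearrangement of $|z|$. The Orlicz space $L_N$ with $N(t)=\exp(t^2)-1$ has norm $\|x\|_N=\inf\{u>0:\int_0^1 N(|x(t)|/u)\,dt\le1\}$, and $G$ is the closure of $L_\infty$ in $L_N$ with the norm of $L_N$. Given a Banach couple $(Y_0,Y_1)$, a space $Y$ with $Y_0\cap Y_1\subset Y\subset Y_0+Y_1$ is an interpolation space between $Y_0$ and $Y_1$ if every linear operator defined on $Y_0+Y_1$ and acting boundedly from $Y_i$ into itself for $i=0,1$ is bounded from $Y$ into itself. The symbol $\asymp$ means two-sided estimates up to positive multiplicative constants. The norm of a function in a space is taken to be $+\infty$ if the function does not belong to that space; thus in the hypothesis, for $a\in l_2$, the sum $\sum_k a_kr_k$ belongs to $X_0$ if and only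 if it belongs to $X_1$. *)

(* Defs.v *)
From HB Require Import structures.
From mathcomp Require Import all_boot all_order all_algebra.
From mathcomp Require Import all_classical all_reals all_analysis.
Set Implicit Arguments.
Unset Strict Implicit.
Unset Printing Implicit Defensive.
Import Order.TTheory GRing.Theory Num.Theory.
Import numFieldNormedType.Exports.
Local Open Scope classical_set_scope.
Local Open Scope ring_scope.

(* Measurable functions on [0, 1] are represented by Borel functions R -> R
   considered modulo equality mu01-almost everywhere, where mu01 is Lebesgue
   measure restricted to [0, 1]: values outside [0, 1] are irrelevant, and every
   Lebesgue measurable function has a Borel representative. *)
Definition mu01 (R : realType) : {measure set (measurableTypeR R) -> \bar R} :=
  mrestr (@lebesgue_measure R) (measurable_itv `[0%R, 1%R]).

Definition ae_eq01 (R : realType) (f g : R -> R) : Prop :=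
  ae_eq (mu01 R) setT f g.

(* A space of functions together with its norm; [fnorm X f] is only meaningful
   for [f] in [carrier X]. *)
Record fspace (R : realType) := Fspace {
  carrier : set (R -> R);
  fnorm : (R -> R) -> R }.

Record is_banach_fspace (R : realType) (X : fspace R) : Prop := {
  banach_measurable : forall f, carrier X f -> measurable_fun setT f ;
  banach_ae : forall f g, carrier X f -> measurable_fun setT g ->
    ae_eq01 f g -> carrier X g ;
  banach_0 : carrier X (fun=> 0) ;
  banach_add : forall f g, carrier X f -> carrier X g -> carrier X (f \+ g) ;
  banach_scale : forall (c : R) f, carrier X f ->
    carrier X (fun t => c * f t) ;
  banach_norm_ge0 : forall f, carrier X f -> 0 <= fnorm X f ;
  banach_norm_eq0 : forall f, carrier X f ->
    (fnorm X f = 0 <-> ae_eq01 f (fun=> 0)) ;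
  banach_normD : forall f g, carrier X f -> carrier X g ->
    fnorm X (f \+ g) <= fnorm X f + fnorm X g ;
  banach_normZ : forall (c : R) f, carrier X f ->
    fnorm X (fun t => c * f t) = `|c| * fnorm X f ;
  banach_complete : forall u : nat -> R -> R,
    (forall n, carrier X (u n)) ->
    (forall e : R, 0 < e -> exists N, forall m n, (N <= m)%N -> (N <= n)%N ->
       fnorm X (u m \- u n) < e) ->
    exists2 f, carrier X f & fnorm X (u n \- f) @[n --> \oo] --> (0 : R) }.

(* The value +oo at t = 0 is possible, as the infimum of the empty set. *)
Definition rearrangement (R : realType) (x : R -> R) (t : R) : \bar R :=
  ereal_inf [set s%:E | s in [set s : R | 0 <= s /\
    (mu01 R [set u : R | (s < `|x u|)%R] <= t%:E)%E]].

Definition rearrangement_invariant (R : realType) (X : fspace R) : Prop :=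
  is_banach_fspace X /\
  forall x y : R -> R, measurable_fun setT x -> carrier X y ->
    (forall t : R, 0 <= t <= 1 -> (rearrangement x t <= rearrangement y t)%E) ->
    carrier X x /\ fnorm X x <= fnorm X y.

Definition Linfty (R : realType) : fspace R := {|
  carrier := [set f : R -> R | f \in Lfun (mu01 R) +oo%E] ;
  fnorm := fun f => fine ('N[mu01 R]_(+oo%E)[EFin \o f])%E |}.

Definition orlicz_norm (R : realType) (N : R -> R) (x : R -> R) : \bar R :=
  ereal_inf [set u%:E | u in [set u : R | 0 < u /\
    (\int[mu01 R]_t (N (`|x t| / u))%:E <= 1)%E]].

Definition orlicz_space (R : realType) (N : R -> R) : fspace R := {|
  carrier := [set x : R -> R | measurable_fun setT x /\
                               (orlicz_norm N x < +oo)%E] ;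
  fnorm := fun x => fine (orlicz_norm N x) |}.

Definition closure_in (R : realType) (X : fspace R) (A : set (R -> R)) :
    fspace R := {|
  carrier := [set x : R -> R | carrier X x /\ forall e : R, 0 < e ->
                exists2 y, A y & carrier X (x \- y) /\ fnorm X (x \- y) < e] ;
  fnorm := fnorm X |}.

Definition Gspace (R : realType) : fspace R :=
  closure_in (orlicz_space (fun t : R => expR (t ^+ 2) - 1))
             (carrier (Linfty R)).

Definition sum_carrier (R : realType) (Y0 Y1 : fspace R) : set (R -> R) :=
  [set f | exists g h, [/\ carrier Y0 g, carrier Y1 h & f = g \+ h]].

(* A linear operator on the almost-everywhere classes of functions of [S]; the
   values of [T] outside [S] are irrelevant. *)
Definition linear_operator_on (R : realType) (S : set (R -> R))
    (T : (R -> R) -> (R -> R)) : Prop :=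
  (forall f g, S f -> S g -> ae_eq01 f g -> ae_eq01 (T f) (T g)) /\
  (forall (c : R) f g, S f -> S g ->
     ae_eq01 (T (fun t => c * f t + g t)) (fun t => c * T f t + T g t)).

Definition bounded_operator_on (R : realType) (Y : fspace R)
    (T : (R -> R) -> (R -> R)) : Prop :=
  exists C : R, forall f, carrier Y f ->
    carrier Y (T f) /\ fnorm Y (T f) <= C * fnorm Y f.

Definition interpolation_space (R : realType) (Y0 Y1 Y : fspace R) : Prop :=
  [/\ carrier Y0 `&` carrier Y1 `<=` carrier Y,
      carrier Y `<=` sum_carrier Y0 Y1 &
      forall T : (R -> R) -> (R -> R),
        linear_operator_on (sum_carrier Y0 Y1) T ->
        bounded_operator_on Y0 T -> bounded_operator_on Y1 T ->
        bounded_operator_on Y T].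

(* Indexed from 0: [rademacher k] is the function sign sin(2^k pi t), usually
   written r_{k+1}. *)
Definition rademacher (R : realType) (k : nat) (t : R) : R :=
  Num.sg (sin (2 ^+ k * pi * t)).

Definition l2 (R : realType) : set (nat -> R) :=
  [set a : nat -> R | cvgn (series (fun k => a k ^+ 2 : R))].

(* For [a] in [l2] the series converges almost everywhere. *)
Definition rademacher_sum (R : realType) (a : nat -> R) : R -> R :=
  fun t => limn (series (fun k => a k * rademacher k t : R)).

Definition xnorm (R : realType) (X : fspace R) (f : R -> R) : \bar R :=
  if `[< carrier X f >] then (fnorm X f)%:E else +oo%E.

Definition asymp_on (R : realType) (I : Type) (P : set I) (u v : I -> \bar R) :
    Prop :=
  exists c C : R, [/\ 0 < c, 0 < C &
    forall i, P i -> (c%:E * v i <= u i <= C%:E * v i)%E].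

(* Main.v *)
Require Import Defs.
From mathcomp Require Import all_boot all_order all_algebra.
From mathcomp Require Import all_classical all_reals all_analysis.
From mathcomp Require Import measurable_realfun ess_sup_inf hoelder.
From mathcomp Require Import ring lra zify.
Set Implicit Arguments.
Unset Strict Implicit.
Unset Printing Implicit Defensive.
Import Order.TTheory GRing.Theory Num.Theory.
Import numFieldNormedType.Exports.
Local Open Scope classical_set_scope.
Local Open Scope ring_scope.

(** Write f* for the nonincreasing rearrangement of a function f.  Membership
    of f in the exponential Orlicz space means that f*(2^(-u^2)) = O(u), and
    up to constants all that an interpolation space between Linfty and G can
    see of f is the quasi-concave envelope
      k(t) = sup over u of f*(2^(-u^2)) min (1, t / u),
    which is the K-functional of f for this couple.  The proof attaches to each
    f in X0 a Rademacher sum g with the same envelope, and reads off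
      f in X0 -> g in X0 -> g in X1 -> f in X1,
    the middle arrow because the hypothesis makes the norm of g in X1 finite
    when its norm in X0 is.  By symmetry the carriers coincide, and then the
    norms are equivalent, as an inclusion of rearrangement invariant spaces is
    automatically bounded ([carrier_sub_bounded]).

    Everything is discretized in powers of 2.  The point x lies in cell j when
    u = sqrt (log_2 (1 / x)) is between 2^j and 2^(j+1), roughly, and
    the values of f* and k are rounded to powers 2^(n i) and 2^(kappa j) at
    u, t = 2^i, 2^j.  The step function equal to 2^(kappa j) on cell j stands
    between f and g, and four implications link the three functions.

    - From f to the step function ([stepfn_pow2_of_function]) and from g to it
      ([stepfn_pow2_of_rademacher_sum]): an operator that puts on cell j a
      multiple of the average of its argument over a set E (i j) is bounded on
      Linfty, and on G because the average of h over a set of measure 2^(-u^2)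
      is O(u) times the norm of h ([avgop_carrier]).  For f the sets E are
      level sets; for g they are the intervals ]0, 2^(-M)[, on which the
      Rademacher functions of index at most M equal 1.
    - From the step function to f and to g: these functions have no larger
      tails than a multiple of it ([stepfn_majorant]).  For g this is
      [rademacher_sum_of_stepfn].

    The coefficients of g are chosen as follows.  The exponent kappa increases
    by 0 or 1 at each step, so at its peaks (an increase followed by a pause)
    both 2^kappa j and 2^j / 2^kappa j at least double from one peak to the
    next, while the peaks still determine all of kappa ([peak_cover]).  Each
    peak j contributes the constant coefficient 2^(kappa j) / 4^j on the block
    of indices from 4^j to 4^(j+1).  Geometric growth gives an l1 bound of order
    2^(kappa j) for the blocks up to j and an l2 bound of order 2^(kappa j) / 2^j
    for the later ones; the subgaussian maximal inequality
    ([rad_incr_max]) turns them into the tail bound for g, and the same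
    inequality gives the almost everywhere convergence of the series.  In the
    other direction the average of g over ]0, 2^(-M)[ is exactly the sum of the
    coefficients of index at most M ([avg_rademacher_sum]), hence at least the
    contribution of any single peak whose block lies there. *)

(** * Lebesgue measure on the unit interval and its hyper-dyadic cells *)

Lemma mu01E (R : realType) (A : set R) :
  mu01 R A = lebesgue_measure (A `&` `[0, 1]).
Proof. by []. Qed.

Lemma mu01T (R : realType) : mu01 R setT = 1%E.
Proof.
rewrite mu01E setTI lebesgue_measure_itv /= lte_fin ltr01.
by rewrite sube0.
Qed.

Lemma mu01_le1 (R : realType) (A : set R) : measurable A -> (mu01 R A <= 1)%E.
Proof. by move=> mA; rewrite -mu01T; apply: le_measure; rewrite ?inE. Qed.

Lemma mu01_oc (R : realType) (b : R) : 0 <= b <= 1 -> mu01 R `]0%R, b]%classic = b%:E.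
Proof.
move=> /andP[b0 b1]; rewrite mu01E setIidl; last first.
  by apply: subset_itv; rewrite bnd_simp.
rewrite lebesgue_measure_itv /= lte_fin; case: ltP => h; first by rewrite sube0.
by congr EFin; apply/eqP; rewrite eq_le b0 h.
Qed.

Lemma ae01_imp (R : realType) (P Q : R -> Prop) : (forall t, P t -> Q t) ->
  {ae mu01 R, forall t, P t} -> {ae mu01 R, forall t, Q t}.
Proof. by move=> PQ; apply: negligibleS => t /= + /PQ; apply. Qed.

Lemma ae01_imp2 (R : realType) (P Q S : R -> Prop) :
  (forall t, P t -> Q t -> S t) ->
  {ae mu01 R, forall t, P t} -> {ae mu01 R, forall t, Q t} ->
  {ae mu01 R, forall t, S t}.
Proof.
move=> PQS P0 Q0; apply: negligibleS (negligibleU P0 Q0) => t /= nS.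
by apply: contrapT => /not_orP[/contrapT Pt /contrapT Qt]; apply: nS; exact: PQS.
Qed.

Lemma pow2_lt_exists (R : realType) (x : R) : exists n : nat, x < 2 ^+ n.
Proof.
exists (Num.truncn x).+1; apply: (lt_trans (truncnS_gt x)).
by rewrite -natrX ltr_nat ltn_expl.
Qed.

Lemma sum_sqr_le (R : realType) (I : Type) (s : seq I) (F : I -> R) :
  (forall i, 0 <= F i) -> \sum_(i <- s) F i ^+ 2 <= (\sum_(i <- s) F i) ^+ 2.
Proof.
move=> F0; elim: s => [|i s IH]; first by rewrite !big_nil expr0n.
rewrite !big_cons; have : 0 <= \sum_(j <- s) F j by apply: sumr_ge0.
by have := F0 i; nra.
Qed.

Lemma sqr_pow2 (R : realType) (i : nat) : (2 ^+ i) ^+ 2 = (4 ^ i)%:R :> R.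
Proof. by rewrite -exprM mulnC exprM -!natrX. Qed.

(** The exponent 4^j - 1, rather than 4^j, makes [dyad R 0] equal to 1 and
    [dyad R j] the length of ]0, 2^(-M)[ for M = 4^j - 1, an interval on which
    the Rademacher functions of index less than 4^j are equal to 1. *)
Definition dyad (R : realType) (j : nat) : R := 2^-1 ^+ (4 ^ j).-1.

Lemma dyad_gt0 (R : realType) j : 0 < dyad R j.
Proof. by rewrite exprn_gt0// invr_gt0. Qed.

Lemma dyad_le1 (R : realType) j : dyad R j <= 1.
Proof. by rewrite exprn_ile1 ?invr_ge0// invf_le1// ler1n. Qed.

Lemma dyad0 (R : realType) : dyad R 0 = 1.
Proof. by rewrite /dyad expn0 expr0. Qed.

Lemma dyad_lt (R : realType) i j : (i < j)%N -> dyad R j < dyad R i.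
Proof.
move=> ij; rewrite /dyad !exprVn ltf_pV2 ?posrE ?exprn_gt0//.
rewrite ltr_eXn2l ?ltr1n//.
have := leq_pexp2l (isT : 0 < 4)%N ij.
by rewrite expnS; have := expn_gt0 4 i; lia.
Qed.

Lemma dyad_le (R : realType) i j : (i <= j)%N -> dyad R j <= dyad R i.
Proof.
by rewrite leq_eqVlt => /orP[/eqP->//|ij]; exact/ltW/dyad_lt.
Qed.

Lemma dyad_lt_exists (R : realType) (x : R) : 0 < x -> exists n : nat, dyad R n < x.
Proof.
move=> x0; have [n xn] := pow2_lt_exists x^-1; exists n.
rewrite /dyad exprVn invf_plt ?posrE ?exprn_gt0//.
apply: (lt_le_trans xn); rewrite ler_eXn2l ?ltr1n//.
have : (n < 4 ^ n)%N by rewrite ltn_expl.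
lia.
Qed.

(** Index of the cell ]dyad (j+1), dyad j] that contains x; the points outside
    ]0, 1] are sent to cell 0, which is harmless as they have measure 0. *)
Definition cell (R : realType) (x : R) : nat :=
  if pselect (exists j, dyad R j.+1 < x) is left h then ex_minn h else 0.

Lemma cell_ge (R : realType) (j : nat) (x : R) : (0 < j)%N ->
  (j <= cell x)%N = (0 < x <= dyad R j).
Proof.
move=> j0; rewrite /cell; case: pselect => [h|h]; last first.
  rewrite leqNgt j0 /=; apply/esym/negbTE/negP => /andP[x0 _]; apply: h.
  have [n nx] := dyad_lt_exists x0.
  by exists n; apply: lt_trans nx; exact: dyad_lt.
case: ex_minnP => m mx min_m.
rewrite (lt_trans (dyad_gt0 _ _) mx) /=; apply/idP/idP => [jm|xj].
  rewrite leNgt; apply/negP => jx.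
  by have := min_m j.-1; rewrite prednK// => /(_ jx); lia.
rewrite leqNgt; apply/negP => mj.
have := lt_le_trans mx xj; rewrite ltNge dyad_le//.
Qed.

Definition cells_from (R : realType) (j : nat) : set R :=
  [set x | (j <= cell x)%N].
Arguments cells_from : clear implicits.

Lemma measurable_cells_from (R : realType) j : measurable (cells_from R j).
Proof.
have [->|j0] := posnP j; first by rewrite (_ : cells_from R 0 = setT)//; apply/seteqP.
rewrite (_ : cells_from R j = `]0, dyad R j]%classic)//.
by apply/seteqP; split=> x /=; rewrite /cells_from/= cell_ge// in_itv.
Qed.

Lemma mu01_cells_from (R : realType) j : mu01 R (cells_from R j) = (dyad R j)%:E.
Proof.
have [->|j0] := posnP j.
  by rewrite dyad0 (_ : cells_from R 0 = setT) ?mu01T//; apply/seteqP.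
rewrite (_ : cells_from R j = `]0, dyad R j]%classic).
  by rewrite mu01_oc// dyad_le1 ltW// dyad_gt0.
by apply/seteqP; split=> x /=; rewrite /cells_from/= cell_ge// in_itv.
Qed.

Definition stepfn (R : realType) (w : nat -> R) (x : R) : R := w (cell x).

Lemma measurable_stepfn (R : realType) (w : nat -> R) :
  measurable_fun setT (stepfn w).
Proof.
move=> _ B mB; rewrite setTI.
rewrite (_ : _ @^-1` _ = \bigcup_(j in [set j | B (w j)])
   (cells_from R j `\` cells_from R j.+1)).
  by apply: bigcup_measurable => j _; apply: measurableD; exact: measurable_cells_from.
apply/seteqP; split=> x /=.
  by move=> Bx; exists (cell x) => //; split; rewrite /cells_from/= ?ltnn.
by case=> j /= Bj [jx /negP xj]; rewrite /stepfn; have -> : cell x = j;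
  [move: jx xj; rewrite /cells_from/=; lia|].
Qed.

(** * Tails of functions and membership in rearrangement invariant spaces *)

Definition tailm (R : realType) (x : R -> R) (s : R) : \bar R :=
  mu01 R [set u : R | (s < `|x u|)%R].

Lemma measurable_gt (R : realType) (x : R -> R) (s : R) :
  measurable_fun setT x -> measurable [set t : R | (s < x t)%R].
Proof.
move=> mx; rewrite (_ : [set _ | _] = x @^-1` `]s, +oo[%classic).
  by rewrite -[X in measurable X]setTI; exact: mx.
by apply/seteqP; split=> t /=; rewrite in_itv/= andbT.
Qed.

Lemma measurable_abs_gt (R : realType) (x : R -> R) (s : R) :
  measurable_fun setT x -> measurable [set t : R | (s < `|x t|)%R].
Proof. by move=> mx; apply: measurable_gt; exact: measurableT_comp. Qed.

Lemma le_tailm (R : realType) (f : R -> R) (r s : R) :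
  measurable_fun setT f -> r <= s -> (tailm f s <= tailm f r)%E.
Proof.
move=> mf rs; apply: le_measure; rewrite ?inE; [exact: measurable_abs_gt|exact: measurable_abs_gt|].
by move=> t /=; exact: le_lt_trans.
Qed.

(** The form in which an almost everywhere bound enters tail estimates; K = 0
    gives monotonicity. *)
Lemma tailm_le_add (R : realType) (f z : R -> R) (K s : R) :
  measurable_fun setT f -> measurable_fun setT z ->
  {ae mu01 R, forall t, `|f t| <= K + `|z t|} ->
  (tailm f (K + s) <= tailm z s)%E.
Proof.
move=> mf mz [N [mN N0 hN]].
rewrite -[leRHS]adde0 -[X in (_ + X)%E]N0.
apply: (@le_trans _ _ (mu01 R ([set t | (s < `|z t|)%R] `|` N))); last first.
  by apply: measureU2 => //; exact: measurable_abs_gt.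
apply: le_measure; rewrite ?inE; [exact: measurable_abs_gt|
  by apply: measurableU => //; exact: measurable_abs_gt|].
move=> t /= ft; apply: contrapT => /not_orP[/= nz nN].
have : `|f t| <= K + `|z t| by apply: contrapT => h; apply: nN; apply: hN.
by move: nz => /negP; rewrite -leNgt => zs; move: ft; rewrite ltNge; lra.
Qed.

(** A smaller tail gives a smaller generalized inverse, which is what the
    rearrangement is. *)
Lemma ri_le_tailm (R : realType) (X : fspace R) (x y : R -> R) :
  rearrangement_invariant X -> measurable_fun setT x -> carrier X y ->
  (forall s : R, 0 <= s -> (tailm x s <= tailm y s)%E) ->
  carrier X x /\ fnorm X x <= fnorm X y.
Proof.
move=> [_ riX] mx Xy xy; apply: riX => // t _.
apply: ereal_inf_le_tmp => _ [s [s0 ys] <-]; exists s => //; split=> //.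
exact: le_trans (xy _ s0) ys.
Qed.

Lemma ri_le_ae (R : realType) (X : fspace R) (x y : R -> R) :
  rearrangement_invariant X -> measurable_fun setT x -> carrier X y ->
  {ae mu01 R, forall t, `|x t| <= `|y t|} ->
  carrier X x /\ fnorm X x <= fnorm X y.
Proof.
move=> riX mx Xy xy; apply: ri_le_tailm => // s _.
rewrite -[X in (tailm x X <= _)%E]add0r; apply: tailm_le_add => //.
- exact: (banach_measurable riX.1 Xy).
- by apply: ae01_imp xy => t; rewrite add0r.
Qed.

(** The tail of a nondecreasing step function takes only the values [dyad R m]
    and 0.  If m is the first index with w m > s, then s is at least w (m - 1),
    so the hypothesis at m - 1 compares the tails of x and of the step function
    at s; if there is no such m, it makes the tail of x at s vanish.  The
    shift by one in the hypothesis is what makes this work on a whole cell. *)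
Lemma stepfn_majorant (R : realType) (X : fspace R) (w : nat -> R) (x : R -> R) :
  rearrangement_invariant X -> measurable_fun setT x ->
  (forall j, 0 <= w j) -> {homo w : i j / (i <= j)%N >-> i <= j} ->
  (forall j, (tailm x (w j) <= (dyad R j.+1)%:E)%E) ->
  carrier X (stepfn w) -> carrier X x.
Proof.
move=> riX mx w0 wh xw Xw; apply: (ri_le_tailm riX mx Xw _).1 => s s0.
have tail_le j : w j <= s -> (tailm x s <= (dyad R j.+1)%:E)%E.
  by move=> wjs; apply: le_trans (xw j); exact: le_tailm.
have [[j sj]|h] := pselect (exists j, s < w j).
  have [m sm min_m] := ex_minnP (ex_intro (fun j => s < w j) j sj).
  have -> : tailm (stepfn w) s = (dyad R m)%:E.
    rewrite -mu01_cells_from; congr (mu01 R _); apply/seteqP; split=> u /=.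
      by rewrite /stepfn ger0_norm// => /min_m.
    by rewrite /stepfn ger0_norm// => /wh; exact: lt_le_trans.
  case: m sm min_m => [|m] sm min_m.
    by rewrite dyad0 mu01_le1//; exact: measurable_abs_gt.
  by apply: tail_le; rewrite leNgt; apply/negP => /min_m; rewrite ltnn.
apply: le_trans (measure_ge0 _ _); apply/lee_addgt0Pr => e e0.
rewrite add0e; have [n ne] := dyad_lt_exists e0.
apply: (le_trans (tail_le n _)).
  by rewrite leNgt; apply/negP => sn; apply: h; exists n.
by rewrite lee_fin (le_trans _ (ltW ne))// dyad_le.
Qed.

(** * Inclusions of rearrangement invariant spaces are bounded *)

Lemma ri_abs (R : realType) (X : fspace R) (x : R -> R) :
  rearrangement_invariant X -> carrier X x ->
  carrier X (fun t => `|x t|) /\ fnorm X (fun t => `|x t|) = fnorm X x.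
Proof.
move=> riX Xx; have mx := banach_measurable riX.1 Xx.
have mx' : measurable_fun setT (fun t => `|x t|) by apply: measurableT_comp mx.
have [Xx' le1] : carrier X (fun t => `|x t|) /\ fnorm X (fun t => `|x t|) <= fnorm X x.
  by apply: ri_le_tailm => // s s0; rewrite /tailm; under eq_set do rewrite normr_id.
split=> //; apply/eqP; rewrite eq_le le1/=.
have [] // := @ri_le_tailm R X x (fun t => `|x t|).
by move=> s s0; rewrite /tailm; under [X in (_ <= mu01 _ X)%E]eq_set do rewrite normr_id.
Qed.

Lemma banach_opp (R : realType) (X : fspace R) (x : R -> R) :
  is_banach_fspace X -> carrier X x ->
  carrier X (\- x) /\ fnorm X (\- x) = fnorm X x.
Proof.
move=> bX Xx; rewrite (_ : \- x = (fun t => -1 * x t)); last first.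
  by apply/funext => t /=; rewrite mulN1r.
by split; [exact: banach_scale|rewrite banach_normZ// normrN1 mul1r].
Qed.

Lemma banach_sum (R : realType) (X : fspace R) (h : nat -> R -> R) (m n : nat) :
  is_banach_fspace X -> (forall i, carrier X (h i)) ->
  carrier X (fun t => \sum_(m <= i < n) h i t) /\
  fnorm X (fun t => \sum_(m <= i < n) h i t) <= \sum_(m <= i < n) fnorm X (h i).
Proof.
move=> bX Xh; have [nm|mn] := leqP n m.
  rewrite [leRHS]big_geq// (_ : (fun t => _) = (fun=> 0)); last first.
    by apply/funext => t; rewrite big_geq.
  split; first exact: banach_0.
  rewrite le_eqVlt; apply/orP; left; apply/eqP/(banach_norm_eq0 bX (banach_0 bX)).
  exact: ae_eq_refl.
elim: n mn => // n IH; rewrite ltnS leq_eqVlt => /orP[/eqP<-|mn].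
  rewrite big_nat1 (_ : (fun t => _) = h m)//.
  by apply/funext => t; rewrite big_nat1.
have [IH1 IH2] := IH mn.
rewrite (_ : (fun t => _) = (fun t => \sum_(m <= i < n) h i t) \+ h n); last first.
  by apply/funext => t; rewrite big_nat_recr//= ltnW.
split; first exact: banach_add.
rewrite big_nat_recr/= 1?ltnW//; apply: (le_trans (banach_normD bX _ _)) => //.
by rewrite lerD2r.
Qed.

Lemma geom_half_sum (R : realType) (m n : nat) :
  \sum_(m <= i < n) (2^-1 : R) ^+ i <= 2 * 2^-1 ^+ m.
Proof.
have [nm|mn] := leqP n m.
  by rewrite big_geq// mulr_ge0// exprn_ge0// invr_ge0.
suff : \sum_(m <= i < n) (2^-1 : R) ^+ i = 2 * 2^-1 ^+ m - 2 * 2^-1 ^+ n.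
  by move=> ->; rewrite gerBl mulr_ge0// exprn_ge0// invr_ge0.
elim: n mn => // n IH; rewrite ltnS leq_eqVlt => /orP[/eqP<-|mn].
  by rewrite big_nat1 exprS; lra.
by rewrite big_nat_recr/= 1?ltnW// IH// exprS; lra.
Qed.

(** Gliding hump.  If the inclusion were unbounded, some nonnegative h n would
    have norm 2^(-n) in X0 and norm at least 2^n in X1.  Their sum g exists in X0
    by completeness and dominates each h n, so its norm in X1 would be infinite.
    Domination is the delicate point, as completeness only gives convergence in
    norm: the positive part of h n - g is dominated by every late partial sum
    minus g, so its norm is 0. *)
Lemma carrier_sub_bounded (R : realType) (X0 X1 : fspace R) :
  rearrangement_invariant X0 -> rearrangement_invariant X1 ->
  carrier X0 `<=` carrier X1 ->
  exists2 C : R, 0 < C & forall f, carrier X0 f -> fnorm X1 f <= C * fnorm X0 f.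
Proof.
move=> ri0 ri1 X01; apply: contrapT => nC.
have : forall n : nat, exists f, carrier X0 f /\ 4 ^+ n * fnorm X0 f < fnorm X1 f.
  move=> n; apply: contrapT => nf; apply: nC; exists (4 ^+ n); first exact: exprn_gt0.
  by move=> f Xf; rewrite leNgt; apply/negP => lt; apply: nf; exists f.
move=> /choice[f fP].
have f0 n : 0 < fnorm X0 (f n).
  have [Xf lt] := fP n; rewrite lt0r banach_norm_ge0//; last exact: ri0.1.
  rewrite andbT; apply/eqP => /(banach_norm_eq0 ri0.1 Xf) f0.
  move/(banach_norm_eq0 ri1.1 (X01 _ Xf)) : f0 => f0.
  move: lt; rewrite f0 ltNge mulr_ge0// ?exprn_ge0// banach_norm_ge0//; exact: ri0.1.
pose c n := (2 ^+ n * fnorm X0 (f n))^-1.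
have c0 n : 0 < c n by rewrite invr_gt0 mulr_gt0// exprn_gt0.
pose h n := fun t => c n * `|f n t|.
have Xf n := (fP n).1.
have Xh n : carrier X0 (h n) by apply: banach_scale (ri_abs ri0 (Xf n)).1; exact: ri0.1.
have nh0 n : fnorm X0 (h n) = 2^-1 ^+ n.
  rewrite /h (banach_normZ ri0.1) ?(ri_abs ri0 (Xf n)).2; last exact: (ri_abs ri0 (Xf n)).1.
  by rewrite gtr0_norm// /c invfM mulfVK ?gt_eqF// exprVn.
have nh1 n : 2 ^+ n <= fnorm X1 (h n).
  rewrite /h (banach_normZ ri1.1) ?(ri_abs ri1 (X01 _ (Xf n))).2; last first.
    exact: (ri_abs ri1 (X01 _ (Xf n))).1.
  rewrite gtr0_norm// /c ler_pdivlMl ?mulr_gt0 ?exprn_gt0//.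
  apply: le_trans (ltW (fP n).2); rewrite mulrAC -exprMn (_ : 2 * 2 = 4 :> R)//.
  by rewrite -natrM.
pose s n := fun t => \sum_(0 <= i < n) h i t.
have Xs n : carrier X0 (s n) by apply: (banach_sum _ _ ri0.1 Xh).1.
have sB m n : (m <= n)%N -> fnorm X0 (s n \- s m) <= 2 * 2^-1 ^+ m.
  move=> mn; rewrite (_ : s n \- s m = fun t => \sum_(m <= i < n) h i t); last first.
    apply/funext => t /=; rewrite /s (@big_cat_nat _ _ _ m)//=.
    by rewrite addrAC subrr add0r.
  apply: (le_trans (banach_sum _ _ ri0.1 Xh).2).
  by rewrite (eq_bigr _ (fun i _ => nh0 i)) geom_half_sum.
have [g Xg sg] : exists2 g, carrier X0 g &
    fnorm X0 (s n \- g) @[n --> \oo] --> (0 : R).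
  apply: (banach_complete ri0.1 Xs) => e e0.
  have [N Ne] := pow2_lt_exists (2 / e).
  exists N => m n Nm Nn.
  have H p q : (N <= p <= q)%N -> fnorm X0 (s q \- s p) < e.
    move=> /andP[Np pq]; apply: (le_lt_trans (sB _ _ pq)).
    rewrite exprVn ltr_pdivrMr ?exprn_gt0// mulrC -ltr_pdivrMr//.
    by apply: (lt_le_trans Ne); rewrite ler_eXn2l ?ltr1n.
  have [mn|/ltnW nm] := leqP m n; last by apply: H; rewrite Nn.
  have -> : s m \- s n = \- (s n \- s m) by apply/funext => t /=; rewrite opprB.
  rewrite (banach_opp ri0.1 _).2 ?H ?Nm//.
  by apply: (banach_add ri0.1) => //; apply: (banach_opp ri0.1 _).1.
have mh n := banach_measurable ri0.1 (Xh n).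
have mg := banach_measurable ri0.1 Xg.
have h0 n t : 0 <= h n t by rewrite mulr_ge0// ltW.
(* The domination of each summand by the sum. *)
have hg n : {ae mu01 R, forall t, h n t <= g t}.
  pose d := fun t => Num.max (h n t - g t) 0.
  have md : measurable_fun setT d.
    by apply: measurable_maxr => //; exact: measurable_funB.
  have dB m : (n < m)%N -> carrier X0 d /\ fnorm X0 d <= fnorm X0 (s m \- g).
    move=> nm; apply: ri_le_ae => //.
      by apply: (banach_add ri0.1) => //; apply: (banach_opp ri0.1 _).1.
    apply: aeW => t /=; rewrite ger0_norm ?le_max ?lexx ?orbT//.
    rewrite ge_max normr_ge0 andbT; apply: le_trans (ler_norm _).
    rewrite lerD2r /s (bigD1_seq n) ?mem_index_iota ?iota_uniq//=.
    by rewrite lerDl sumr_ge0.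
  have Xd := (dB n.+1 (ltnSn _)).1.
  have d0 : fnorm X0 d = 0.
    apply/eqP; rewrite eq_le banach_norm_ge0 ?andbT//; last exact: ri0.1.
    apply: (@cvgr_to_ge _ _ _ _ (fun m => fnorm X0 (s m \- g)) _ _ sg).
    by near=> m; apply: (dB m _).2; near: m; exact: nbhs_infty_gt.
  have := (banach_norm_eq0 ri0.1 Xd).1 d0.
  apply: ae01_imp => t /(_ Logic.I) dt.
  by rewrite -subr_le0 -dt /d le_max lexx.
have [n gn] := pow2_lt_exists (fnorm X1 g).
have [] := @ri_le_ae R X1 (h n) g ri1 (mh n) (X01 _ Xg).
  apply: ae01_imp (hg n) => t; rewrite ger0_norm// => /le_trans; apply; exact: ler_norm.
by move=> _; rewrite leNgt (lt_le_trans gn).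
Unshelve. all: by end_near. Qed.

(** * The couple of bounded functions and exponentially square integrable functions *)

Lemma LinftyP (R : realType) (f : R -> R) :
  carrier (Linfty R) f <-> measurable_fun setT f /\
    exists M : R, {ae mu01 R, forall t, `|f t| <= M}.
Proof.
have mu1 : (0 < mu01 R setT)%E by rewrite mu01T.
split.
  rewrite /Linfty/= => /andP[]; rewrite !inE /= /finite_norm unlock mu1 => mf fy.
  split=> //; have [M hM] := ess_supr_bounded fy.
  by exists M; apply: ae01_imp hM.
move=> [mf [M hM]]; apply/andP; split; rewrite !inE //= /finite_norm unlock mu1.
apply: (@le_lt_trans _ _ M%:E); last exact: ltry.
by apply/ess_supP; apply: ae01_imp hM => t /=; rewrite lee_fin.
Qed.

Lemma Linfty_norm_le (R : realType) (f : R -> R) (M : R) :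
  {ae mu01 R, forall t, `|f t| <= M} -> fnorm (Linfty R) f <= M.
Proof.
have mu1 : (0 < mu01 R setT)%E by rewrite mu01T.
move=> fM; rewrite /= unlock mu1.
have : (ess_sup (mu01 R) (abse \o (EFin \o f)) <= M%:E)%E.
  by apply/ess_supP; apply: ae01_imp fM => t /=; rewrite lee_fin.
have : (0 <= ess_sup (mu01 R) (abse \o (EFin \o f)))%E.
  by apply: ess_sup_gee => //; apply: aeW => t /=.
by case: ess_sup => //= r _; rewrite lee_fin.
Qed.

Lemma Linfty_ae_le (R : realType) (f : R -> R) : carrier (Linfty R) f ->
  {ae mu01 R, forall t, `|f t| <= fnorm (Linfty R) f}.
Proof.
have mu1 : (0 < mu01 R setT)%E by rewrite mu01T.
move=> /andP[_]; rewrite inE /= /finite_norm unlock mu1.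
have := ess_sup_ge (mu01 R) (abse \o (EFin \o f)).
have : (0 <= ess_sup (mu01 R) (abse \o (EFin \o f)))%E.
  by apply: ess_sup_gee => //; apply: aeW => t /=.
by case: ess_sup => //= r _ + _.
Qed.

Definition expsq (R : realType) (t : R) : R := expR (t ^+ 2) - 1.

Lemma expsq_ge0 (R : realType) (t : R) : 0 <= expsq t.
Proof. by rewrite subr_ge0 -expR0 ler_expR sqr_ge0. Qed.

Lemma expsq_le (R : realType) (s t : R) : 0 <= s <= t -> expsq s <= expsq t.
Proof.
move=> /andP[s0 st]; rewrite lerD2r ler_expR lerXn2r// ?nnegrE//.
exact: le_trans st.
Qed.

Lemma measurable_expsq (R : realType) : measurable_fun setT (@expsq R).
Proof.
by apply: measurable_funB => //; exact: measurableT_comp.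
Qed.

(** The condition that defines the values u in the Luxemburg norm of x: it says
    that x has norm at most u, and it is easier to handle than the infimum. *)
Definition orlicz_le (R : realType) (x : R -> R) (u : R) : Prop :=
  0 < u /\ (\int[mu01 R]_t (expsq (`|x t| / u))%:E <= 1)%E.

Lemma orlicz_norm_ge0 (R : realType) (x : R -> R) :
  (0 <= orlicz_norm (@expsq R) x)%E.
Proof. by apply: le_ereal_inf_tmp => _ [u [u0 _] <-]; rewrite lee_fin ltW. Qed.

Lemma orlicz_leP (R : realType) (x : R -> R) (u : R) :
  orlicz_le x u -> (orlicz_norm (@expsq R) x <= u%:E)%E.
Proof. by move=> xu; apply: ge_ereal_inf; exists u%:E => //; exists u. Qed.

Lemma orlicz_fin (R : realType) (x : R -> R) (u : R) : orlicz_le x u ->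
  (orlicz_norm (@expsq R) x < +oo)%E /\ fine (orlicz_norm (@expsq R) x) <= u.
Proof.
move=> /orlicz_leP; have := orlicz_norm_ge0 x.
case: (orlicz_norm _ _) => //= r _; by rewrite lee_fin ltry.
Qed.

Lemma orlicz_lt (R : realType) (x : R -> R) (v : R) :
  (orlicz_norm (@expsq R) x < +oo)%E -> fine (orlicz_norm (@expsq R) x) < v ->
  exists2 u, orlicz_le x u & u < v.
Proof.
move=> fx; rewrite -lte_fin fineK; last by rewrite ge0_fin_numE// orlicz_norm_ge0.
by move=> /ereal_inf_lt[_ [u xu <-]]; rewrite lte_fin; exists u.
Qed.

Lemma measurable_expsq_abs (R : realType) (x : R -> R) (u : R) (E : set R) :
  measurable_fun setT x ->
  measurable_fun E (fun t => (expsq (`|x t| / u))%:E).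
Proof.
move=> mx; apply/measurable_EFinP; apply: measurable_funTS.
apply: (measurableT_comp (@measurable_expsq R)).
by apply: measurable_funM => //; exact: measurableT_comp.
Qed.

(** For y >= A this is y - A <= y^2 - A^2 <= expR (y^2 - A^2).  It plays the
    role of Jensen inequality for the inverse of [expsq] in the bounds on
    averages. *)
Lemma le_expsq (R : realType) (A y : R) : 1 <= A -> 0 <= y ->
  y <= A + expR (- A ^+ 2) * (1 + expsq y).
Proof.
move=> A1 y0; rewrite /expsq addrCA subrr addr0 -expRD.
have [yA|Ay] := leP y A.
  by rewrite (le_trans yA)// lerDl expR_ge0.
rewrite -lerBlDl; apply: le_trans (_ : 1 + (- A ^+ 2 + y ^+ 2) <= _); last first.
  exact: expR_ge1Dx.
nra.
Qed.

Lemma expRN_nat_le (R : realType) (n : nat) : expR (- n%:R) <= 2^-1 ^+ n :> R.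
Proof.
rewrite -mulN1r expRM_natr lerXn2r ?nnegrE ?invr_ge0 ?expR_ge0//.
rewrite expRN lef_pV2 ?posrE ?expR_gt0//.
by apply: le_trans (expR_ge1Dx 1); lra.
Qed.

Lemma expRN_sqr_le_dyad (R : realType) (i : nat) :
  expR (- (2 ^+ i) ^+ 2) <= dyad R i.
Proof.
rewrite sqr_pow2 (le_trans (expRN_nat_le _ _))// /dyad !exprVn.
rewrite lef_pV2 ?posrE ?exprn_gt0// ler_eXn2l ?ltr1n//.
exact: leq_pred.
Qed.

(** Choosing A with expR (- A^2) <= mu01 R E makes the exponential term of
    [le_expsq] contribute at most 2 to the average of |x| / u over E. *)
Lemma orlicz_int_le (R : realType) (x : R -> R) (u A : R) (E : set R) :
  measurable_fun setT x -> orlicz_le x u -> 1 <= A -> measurable E ->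
  ((expR (- A ^+ 2))%:E <= mu01 R E)%E ->
  (\int[mu01 R]_(t in E) `|x t|%:E <= ((A + 2) * u)%:E * mu01 R E)%E.
Proof.
move=> mx [u0 xu] A1 mE AE.
set q := expR (- A ^+ 2).
have q0 : 0 <= q by exact: expR_ge0.
have q1 : q <= 1 by rewrite -expR0 ler_expR oppr_le0 sqr_ge0.
apply: (@le_trans _ _ (\int[mu01 R]_(t in E)
   (((A + q) * u)%:E + (q * u)%:E * (expsq (`|x t| / u))%:E))%E).
  apply: ge0_le_integral => //.
  - by apply/measurable_EFinP/measurable_funTS; exact: measurableT_comp.
  - apply: emeasurable_funD => //; apply: measurable_funeM.
    exact: measurable_expsq_abs.
  - move=> t Et; rewrite -EFinM -EFinD lee_fin.
    have := @le_expsq R A (`|x t| / u) A1; rewrite divr_ge0 ?(ltW u0)// => /(_ isT).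
    by rewrite ler_pdivrMr// -/q => /le_trans; apply; lra.
rewrite ge0_integralD//; first last.
- by apply: measurable_funeM; exact: measurable_expsq_abs.
- by move=> t _; rewrite -EFinM lee_fin !mulr_ge0// ?(ltW u0)// expsq_ge0.
- by move=> t _; rewrite lee_fin mulr_ge0 ?(ltW u0)//; lra.
rewrite integral_cst// ge0_integralZl//; first last.
- by rewrite lee_fin mulr_ge0// ltW.
- by move=> t _; rewrite lee_fin expsq_ge0.
- exact: measurable_expsq_abs.
have IE : (\int[mu01 R]_(t in E) (expsq (`|x t| / u))%:E <= 1)%E.
  apply: le_trans xu; apply: ge0_subset_integral => //.
    exact: measurable_expsq_abs.
  by move=> t _; rewrite lee_fin expsq_ge0.
have : mu01 R E \is a fin_num.
  by rewrite ge0_fin_numE// (le_lt_trans (mu01_le1 mE))// ltry.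
move: AE IE; rewrite -/q.
have : (0 <= \int[mu01 R]_(t in E) (expsq (`|x t| / u))%:E)%E.
  by apply: integral_ge0 => t _; rewrite lee_fin expsq_ge0.
case: integral => // I; case: (mu01 R E) => // m; rewrite !lee_fin => I0 qm I1 _.
have m0 : 0 <= m by exact: le_trans qm.
have : q * u * I <= q * u * 1 by rewrite ler_wpM2l// mulr_ge0// ltW.
have : u * q <= u * m by rewrite ler_wpM2l// ltW.
have : q * (u * m) <= 1 * (u * m) by rewrite ler_wpM2r// mulr_ge0// ltW.
by lra.
Qed.

Lemma expsq_pow2_ge (R : realType) (i : nat) :
  1 <= dyad R i * expsq (2 ^+ i.+1).
Proof.
have := expRN_sqr_le_dyad R i; rewrite /expsq !sqr_pow2 expnS natrM expRM_natl => h.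
set x := expR (4 ^ i)%:R.
have x2 : 2 <= x.
  rewrite /x; apply: le_trans (expR_ge1Dx _).
  have : 1 <= (4 ^ i)%:R :> R by rewrite ler1n expn_gt0.
  lra.
have : expR (- (4 ^ i)%:R) * x = 1 by rewrite -expRD addrC subrr expR0.
move: h; move: (expR (- _)) (dyad R i) => y d yd yx.
have y0 : 0 < y by nra.
apply: (@le_trans _ _ (y * (x ^+ 4 - 1))); last first.
  by rewrite ler_wpM2r// subr_ge0 exprn_ege1//; lra.
have x4 : x <= x ^+ 4 - 1.
  have h2 : 4 <= x ^+ 2 by nra.
  by rewrite (_ : 4 = 2 * 2)%N// exprM; nra.
by rewrite -[leLHS]yx ler_wpM2l// ltW.
Qed.

(** Chebyshev inequality for [expsq]. *)
Lemma orlicz_tail (R : realType) (x : R -> R) (u s : R) (i : nat) :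
  measurable_fun setT x -> orlicz_le x u -> 2 ^+ i.+1 * u <= s ->
  (tailm x s <= (dyad R i)%:E)%E.
Proof.
move=> mx [u0 xu] us.
have mA := measurable_abs_gt s mx.
rewrite /tailm; set A := [set _ | _] in mA *.
set L := expsq (2 ^+ i.+1 : R).
have LI : (L%:E * mu01 R A <= 1)%E.
  rewrite -(integral_cst (mu01 R) mA); apply: le_trans xu.
  apply: (@le_trans _ _ (\int[mu01 R]_(t in A) (expsq (`|x t| / u))%:E)%E).
    apply: ge0_le_integral => //.
    - by move=> t _; rewrite lee_fin expsq_ge0.
    - exact: measurable_expsq_abs.
    - move=> t /= st; rewrite lee_fin; apply: expsq_le.
      by rewrite exprn_ge0//= ler_pdivlMr// (le_trans us)// ltW.
  apply: ge0_subset_integral => //; first exact: measurable_expsq_abs.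
  by move=> t _; rewrite lee_fin expsq_ge0.
move: LI; have : mu01 R A \is a fin_num.
  by rewrite ge0_fin_numE// (le_lt_trans (mu01_le1 mA))// ltry.
have := expsq_pow2_ge R i; rewrite -/L.
have d0 := dyad_gt0 R i.
case: (mu01 R A) => // m dL _; rewrite -EFinM !lee_fin => Lm.
have L0 : 0 < L by nra.
by rewrite -(ler_pM2l L0); nra.
Qed.

Lemma Gspace_orlicz (R : realType) (f : R -> R) : carrier (Gspace R) f ->
  measurable_fun setT f /\ exists u, orlicz_le f u.
Proof.
move=> [[mf fy] _]; split=> //.
have [|u fu _] := @orlicz_lt R f (fine (orlicz_norm (@expsq R) f) + 1) fy.
  by rewrite ltrDl.
by exists u.
Qed.

(** This approximation by bounded functions is what distinguishes G from the
    whole Orlicz space. *)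
Lemma Gspace_approx (R : realType) (f : R -> R) (e : R) :
  carrier (Gspace R) f -> 0 < e ->
  exists y, [/\ carrier (Linfty R) y, measurable_fun setT (f \- y) &
    exists2 u, orlicz_le (f \- y) u & u < e].
Proof.
move=> [_ fG] e0; have [y Ly [[my yoo] ye]] := fG _ e0.
by exists y; split => //; apply: orlicz_lt ye.
Qed.

Lemma integrable_bounded01 (R : realType) (f : R -> R) (M : \bar R) :
  measurable_fun setT f -> (\int[mu01 R]_t `|f t|%:E <= M)%E -> (M < +oo)%E ->
  (mu01 R).-integrable setT (EFin \o f).
Proof.
move=> mf fM My; apply/integrableP; split; first exact/measurable_EFinP.
exact: le_lt_trans My.
Qed.

Lemma Linfty_integrable (R : realType) (f : R -> R) :
  carrier (Linfty R) f -> (mu01 R).-integrable setT (EFin \o f).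
Proof.
move=> /LinftyP[mf [M fM]].
apply: (@integrable_bounded01 _ _ `|M|%:E) => //; last exact: ltry.
rewrite -[leRHS]mule1 -(mu01T R) -integral_cst//.
apply: ae_ge0_le_integral => //.
- by apply/measurable_EFinP; exact: measurableT_comp.
- by move=> t _; rewrite lee_fin.
- by apply: ae01_imp fM => t ft _; rewrite lee_fin (le_trans ft)// ler_norm.
Qed.

Lemma orlicz_integrable (R : realType) (f : R -> R) (u : R) :
  measurable_fun setT f -> orlicz_le f u ->
  (mu01 R).-integrable setT (EFin \o f).
Proof.
move=> mf fu.
have A1 : ((expR (- (1 ^+ 2)))%:E <= mu01 R setT)%E.
  by rewrite mu01T lee_fin expr1n (le_trans (expRN_nat_le R 1))// expr1 invf_le1 ?ler1n.
apply: (integrable_bounded01 mf (orlicz_int_le mf fu (lexx _) measurableT A1)).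
by rewrite mu01T mule1 ltry.
Qed.

Lemma sum_carrier_integrable (R : realType) (f : R -> R) :
  sum_carrier (Linfty R) (Gspace R) f ->
  measurable_fun setT f /\ (mu01 R).-integrable setT (EFin \o f).
Proof.
move=> [g [h [Lg Gh ->]]].
have [mg _] := (LinftyP g).1 Lg; have [mh [u hu]] := Gspace_orlicz Gh.
split; first exact: measurable_funD.
have -> : EFin \o (g \+ h) = (EFin \o g) \+ (EFin \o h) by [].
apply: integrableD => //; [exact: Linfty_integrable|exact: orlicz_integrable hu].
Qed.

(** * Averages, step functions and averaging operators *)

Definition avg (R : realType) (E : set R) (h : R -> R) : R :=
  (fine (mu01 R E))^-1 * \int[mu01 R]_(t in E) h t.

Lemma avg_ae_eq (R : realType) (E : set R) (f g : R -> R) :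
  measurable E -> measurable_fun setT f -> measurable_fun setT g ->
  ae_eq01 f g -> avg E f = avg E g.
Proof.
move=> mE mf mg fg; congr (_ * fine _); apply: ae_eq_integral => //.
- exact/measurable_EFinP/measurable_funTS.
- exact/measurable_EFinP/measurable_funTS.
- by apply: ae01_imp fg => t /(_ Logic.I) /= + _ => ->.
Qed.

Lemma avg_lin (R : realType) (E : set R) (c : R) (f g : R -> R) :
  measurable E -> (mu01 R).-integrable setT (EFin \o f) ->
  (mu01 R).-integrable setT (EFin \o g) ->
  avg E (fun t => c * f t + g t) = c * avg E f + avg E g.
Proof.
move=> mE If Ig.
have IE k : (mu01 R).-integrable setT (EFin \o k) -> (mu01 R).-integrable E (EFin \o k).
  by apply: integrableS.
rewrite /avg RintegralD//; last 2 first.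
- by apply: IE; exact: (integrableZl measurableT c If).
- exact: IE.
rewrite RintegralZl//; last exact: IE.
ring.
Qed.

Lemma avg_norm_le (R : realType) (E : set R) (h : R -> R) (C : R) :
  measurable E -> (mu01 R).-integrable setT (EFin \o h) ->
  (0 < mu01 R E)%E -> 0 <= C ->
  (\int[mu01 R]_(t in E) `|h t|%:E <= C%:E * mu01 R E)%E -> `|avg E h| <= C.
Proof.
move=> mE Ih.
have muE : (mu01 R E = (fine (mu01 R E))%:E).
  by rewrite fineK// ge0_fin_numE// (le_lt_trans (mu01_le1 mE))// ltry.
rewrite muE lte_fin => E0 C0 hC.
have IE : (mu01 R).-integrable E (EFin \o h) by apply: integrableS Ih.
rewrite /avg normrM normfV (gtr0_norm E0) ler_pdivrMl// mulrC.
rewrite -lee_fin (EFinM C) (le_trans _ hC)// EFin_normr_Rintegral//.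
by apply: le_abse_integral => //; case/integrableP: IE.
Qed.

Lemma avg_ge (R : realType) (E : set R) (h : R -> R) (c : R) :
  measurable E -> (mu01 R).-integrable setT (EFin \o h) ->
  (0 < mu01 R E)%E -> (forall t, E t -> c <= h t) -> c <= avg E h.
Proof.
move=> mE Ih.
have muE : (mu01 R E = (fine (mu01 R E))%:E).
  by rewrite fineK// ge0_fin_numE// (le_lt_trans (mu01_le1 mE))// ltry.
rewrite muE lte_fin => E0 hc.
rewrite /avg ler_pdivlMl// mulrC -Rintegral_cst//; apply: le_Rintegral => //.
  apply: (@integrableS _ _ _ _ setT) => //.
  apply: Linfty_integrable; apply/LinftyP; split => //; exists `|c|.
  by apply: aeW.
by apply: integrableS Ih.
Qed.

(** The measure of the cells decays like 2^(-4^j), fast enough to beat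
    expR (4^j / 16) and leave a series of sum at most 1. *)
Lemma expsq_dyad_le (R : realType) (j : nat) :
  expsq (2 ^+ j / 4) * dyad R j <= 1 / (2 ^ (j + 1))%:R.
Proof.
rewrite /expsq /dyad expr_div_n sqr_pow2 mulrC.
have -> : expR ((4 ^ j)%:R / 4 ^+ 2) = expR (16^-1) ^+ (4 ^ j) :> R.
  by rewrite mulrC expRM_natr -natrX.
(* With b = expR (1 / 16), the left-hand side is at most b (b / 2)^(4^j - 1). *)
set b : R := expR (16^-1).
have b1 : 1 <= b by rewrite -[leLHS]expR0 ler_expR; lra.
have b2 : b <= 16 / 15.
  have : b * expR (- 16^-1) = 1 by rewrite -expRD subrr expR0.
  have : 1 + - 16^-1 <= expR (- 16^-1) :> R by exact: expR_ge1Dx.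
  nra.
have n3 : (3 * j <= (4 ^ j).-1)%N.
  elim: j => // j IH; rewrite expnS; have := expn_gt0 4 j; lia.
have -> : (4 ^ j)%N = (4 ^ j).-1.+1 by rewrite prednK// expn_gt0.
rewrite /=; case: j n3 => [|j] n3.
  by rewrite expn0 !expr0 expr1 /= !mul1r add0n expn1; lra.
move: (_.-1) n3 => n n3.
have lt : 2^-1 ^+ n * (b ^+ n.+1 - 1) <= b * (b / 2) ^+ n.
  rewrite exprS expr_div_n exprVn.
  have h : 0 < (2 ^+ n)^-1 :> R by rewrite invr_gt0 exprn_gt0.
  by rewrite mulrBr mulr1; nra.
apply: (le_trans lt).
have h1 : (b / 2) ^+ n <= (8 / 15) ^+ n by rewrite lerXn2r ?nnegrE; lra.
have h2 : (8 / 15 : R) ^+ n <= (8 / 15) ^+ (3 * j.+1).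
  by apply: ler_wiXn2l => //; lra.
have h3 : (8 / 15 : R) ^+ (3 * j.+1) <= (6^-1) ^+ j.+1.
  by rewrite exprM lerXn2r ?nnegrE; lra.
have h4 : (6^-1 : R) ^+ j.+1 <= 6^-1 * (2^-1) ^+ j.
  by rewrite exprS ler_wpM2l// ?lerXn2r ?nnegrE; lra.
have h5 : 0 <= (2^-1 : R) ^+ j by rewrite exprn_ge0; lra.
have -> : 1 / (2 ^ (j.+1 + 1))%:R = 4^-1 * 2^-1 ^+ j :> R.
  by rewrite natrX addn1 !exprS exprVn !invfM; lra.
nra.
Qed.

(** The function 2^j on cell j is, up to constants, the largest nonincreasing
    function of the unit ball of the Orlicz space; here its norm is bounded by
    summing over the sets [cells_from R j]. *)
Lemma stepfn_orlicz (R : realType) (w : nat -> R) (D : R) : 0 < D ->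
  (forall j, `|w j| <= D * 2 ^+ j) -> orlicz_le (stepfn w) (4 * D).
Proof.
move=> D0 wD; have D4 : 0 < 4 * D by lra.
split=> //.
pose v j : R := expsq (2 ^+ j / 4).
have v0 j : (0 <= v j)%R by exact: expsq_ge0.
(* The value v (cell t) is one term of the sum over all j <= cell t. *)
pose F j t := ((v j)%:E * (\1_(cells_from R j) t)%:E)%E.
have F0 j t : (0 <= F j t)%E by rewrite /F -EFinM lee_fin mulr_ge0.
have mF j : measurable_fun setT (F j).
  apply: measurable_funeM; apply/measurable_EFinP.
  by apply: measurable_indic; exact: measurable_cells_from.
apply: (@le_trans _ _ (\int[mu01 R]_t (\sum_(0 <= j <oo) F j t))%E).
  apply: ge0_le_integral => //.
  - by move=> t _; rewrite lee_fin expsq_ge0.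
  - by apply: measurable_expsq_abs; exact: measurable_stepfn.
  - by apply: (@ge0_emeasurable_sum _ _ R setT F predT).
  move=> t _.
  apply: (@le_trans _ _ (\sum_(0 <= j < (cell t).+1) F j t)%E); last first.
    exact: nneseries_lim_ge.
  rewrite big_nat_recr//= /F indicE mem_set ?mule1; last by rewrite /cells_from/=.
  rewrite -[leLHS]add0e leeD//; first by apply: sume_ge0 => j _; exact: (F0 j t).
  rewrite lee_fin; apply: expsq_le; rewrite divr_ge0 ?(ltW D4)//=.
  rewrite ler_pdivrMr// (le_trans (wD (cell t)))//; lra.
rewrite integral_nneseries//.
have -> : (1 = \sum_(0 <= j <oo) (1 / (2 ^ (j + 1))%:R : R)%:E)%E.
  have := @cvg_geometric_eseries_half R 1 0.
  by rewrite expr0 divr1 => /cvg_lim <-.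
apply: lee_nneseries => j _; first by move=> _; exact: integral_ge0.
rewrite integralZl//; last first.
  apply: Linfty_integrable; apply/LinftyP; split.
    by apply: measurable_indic; exact: measurable_cells_from.
  by exists 1; apply: aeW => t; rewrite indicE; case: (_ \in _); rewrite ?normr0 ?normr1.
rewrite integral_indic//; last exact: measurable_cells_from.
by rewrite setIT mu01_cells_from -EFinM lee_fin expsq_dyad_le.
Qed.

(** The factor is min (1, 2^j / 2^(i j)).  It compensates the growth 2^(i j) of
    averages over sets of measure about [dyad R (i j)] for functions of the
    Orlicz space, without spoiling the bound on bounded functions. *)
Definition avgop (R : realType) (E : nat -> set R) (i : nat -> nat)
    (h : R -> R) : R -> R :=
  stepfn (fun j => 2^-1 ^+ (i j - j) * avg (E (i j)) h).

Lemma half_pow_sub (R : realType) (i j : nat) :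
  2^-1 ^+ (i - j) * 2 ^+ i <= 2 ^+ j :> R.
Proof.
have [ij|/ltnW ij] := leqP j i.
  rewrite -{2}(subnK ij) exprD mulrA exprVn mulVf ?mul1r//.
have -> : (i - j = 0)%N by lia.
by rewrite expr0 mul1r ler_eXn2l ?ltr1n.
Qed.

Lemma half_pow_le1 (R : realType) (n : nat) : 0 <= (2^-1 : R) ^+ n <= 1.
Proof. by rewrite exprn_ge0 ?exprn_ile1 ?invr_ge0 ?invf_le1 ?ler1n. Qed.

Lemma avgop_Linfty (R : realType) (E : nat -> set R) (i : nat -> nat)
    (h : R -> R) :
  (forall n, measurable (E n)) -> (forall n, ((dyad R n.+1)%:E <= mu01 R (E n))%E) ->
  carrier (Linfty R) h -> carrier (Linfty R) (avgop E i h) /\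
  fnorm (Linfty R) (avgop E i h) <= fnorm (Linfty R) h.
Proof.
move=> mE Ege Lh; have hM := Linfty_ae_le Lh.
have [mh _] := (LinftyP h).1 Lh.
have M0 : 0 <= fnorm (Linfty R) h.
  by rewrite /= fine_ge0// Lnorm_ge0.
have E0 n : (0 < mu01 R (E n))%E.
  by apply: lt_le_trans (Ege n); rewrite lte_fin dyad_gt0.
have wM t : `|avgop E i h t| <= fnorm (Linfty R) h.
  rewrite /avgop /stepfn normrM ger0_norm; last by case/andP: (half_pow_le1 R (i (cell t) - cell t)).
  rewrite -[leRHS]mul1r ler_pM//; [by case/andP: (half_pow_le1 R (i (cell t) - cell t))..|].
  apply: avg_norm_le => //; first exact: Linfty_integrable.
  apply: (@le_trans _ _ (\int[mu01 R]_(s in E (i (cell t))) (fnorm (Linfty R) h)%:E)%E);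
    last by rewrite integral_cst//; exact: mE.
  apply: ae_ge0_le_integral => //; first exact: mE.
  - by apply/measurable_EFinP/measurable_funTS; exact: measurableT_comp.
  - by apply: ae01_imp hM => s hs _; rewrite lee_fin.
split; last by apply: Linfty_norm_le; apply: aeW.
apply/LinftyP; split; first exact: measurable_stepfn.
by exists (fnorm (Linfty R) h); apply: aeW.
Qed.

(** On cell j the function [avgop E i h] is at most 4 u 2^j by the average
    bound [orlicz_int_le] and [half_pow_sub], and [stepfn_orlicz] costs a
    further factor 4. *)
Lemma avgop_orlicz (R : realType) (E : nat -> set R) (i : nat -> nat)
    (h : R -> R) (u : R) :
  (forall n, measurable (E n)) -> (forall n, ((dyad R n.+1)%:E <= mu01 R (E n))%E) ->
  measurable_fun setT h -> orlicz_le h u -> orlicz_le (avgop E i h) (16 * u).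
Proof.
move=> mE Ege mh hu; have u0 := hu.1.
have E0 n : (0 < mu01 R (E n))%E.
  by apply: lt_le_trans (Ege n); rewrite lte_fin dyad_gt0.
rewrite (_ : 16 * u = 4 * (4 * u)); last lra.
apply: stepfn_orlicz => [|j]; first lra.
have /andP[c0 _] := half_pow_le1 R (i j - j).
rewrite normrM ger0_norm//.
have P1 : 1 <= 2 ^+ i j :> R by rewrite exprn_ege1// ler1n.
have : `|avg (E (i j)) h| <= (2 ^+ (i j).+1 + 2) * u.
  apply: avg_norm_le => //.
  - exact: orlicz_integrable hu.
  - by rewrite mulr_ge0 ?(ltW u0)// addr_ge0// exprn_ge0.
  - apply: orlicz_int_le => //; first by rewrite exprn_ege1// ler1n.
    by apply: le_trans (Ege _); rewrite lee_fin expRN_sqr_le_dyad.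
rewrite exprS => avgu.
apply: (@le_trans _ _ (2^-1 ^+ (i j - j) * ((4 * u) * 2 ^+ i j))).
  by rewrite ler_wpM2l// (le_trans avgu)//; nra.
by rewrite mulrCA ler_wpM2l ?half_pow_sub//; lra.
Qed.

Lemma avgop_lin (R : realType) (E : nat -> set R) (i : nat -> nat) (c : R)
    (f g : R -> R) :
  (forall n, measurable (E n)) -> (mu01 R).-integrable setT (EFin \o f) ->
  (mu01 R).-integrable setT (EFin \o g) ->
  avgop E i (fun t => c * f t + g t) = (fun t => c * avgop E i f t + avgop E i g t).
Proof.
move=> mE If Ig; apply/funext => t; rewrite /avgop /stepfn avg_lin//.
ring.
Qed.

(** Linearity carries an approximation of h by a bounded function y to an
    approximation of its image by the image of y. *)
Lemma avgop_Gspace (R : realType) (E : nat -> set R) (i : nat -> nat)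
    (h : R -> R) :
  (forall n, measurable (E n)) -> (forall n, ((dyad R n.+1)%:E <= mu01 R (E n))%E) ->
  carrier (Gspace R) h -> carrier (Gspace R) (avgop E i h) /\
  fnorm (Gspace R) (avgop E i h) <= 16 * fnorm (Gspace R) h.
Proof.
move=> mE Ege Gh; have [mh [u hu]] := Gspace_orlicz Gh.
have mT := @measurable_stepfn R.
split; last first.
  apply/ler_addgt0Pr => e e0.
  have [|v hv vlt] := @orlicz_lt R h (fnorm (Gspace R) h + e / 16) Gh.1.2.
    by rewrite ltrDl divr_gt0.
  have := (orlicz_fin (avgop_orlicz i mE Ege mh hv)).2.
  by move=> /le_trans; apply; lra.
split.
  split; first exact: mT.
  exact: (orlicz_fin (avgop_orlicz i mE Ege mh hu)).1.
move=> e e0; have [|y [Ly mhy [v hv ve]]] := @Gspace_approx R h (e / 16) Gh.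
  by rewrite divr_gt0.
exists (avgop E i y); first exact: (avgop_Linfty i mE Ege Ly).1.
have -> : avgop E i h \- avgop E i y = avgop E i (h \- y).
  rewrite (_ : h \- y = (fun t => -1 * y t + h t)); last first.
    by apply/funext => t /=; ring.
  rewrite avgop_lin//; [|exact: Linfty_integrable|exact: orlicz_integrable hu].
  by apply/funext => t /=; ring.
have [fin1 fin2] := orlicz_fin (avgop_orlicz i mE Ege mhy hv).
split; first by split; [exact: mT|exact: fin1].
by apply: (le_lt_trans fin2); lra.
Qed.

Lemma avgop_carrier (R : realType) (X : fspace R) (E : nat -> set R)
    (i : nat -> nat) (h : R -> R) :
  interpolation_space (Linfty R) (Gspace R) X ->
  (forall n, measurable (E n)) -> (forall n, ((dyad R n.+1)%:E <= mu01 R (E n))%E) ->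
  carrier X h -> carrier X (avgop E i h).
Proof.
move=> [_ _ intX] mE Ege Xh.
have [] := intX (avgop E i).
- split.
    move=> f g /sum_carrier_integrable[mf If] /sum_carrier_integrable[mg Ig] fg.
    have -> : avgop E i f = avgop E i g.
      by apply/funext => t; rewrite /avgop /stepfn (avg_ae_eq (mE _) mf mg fg).
    exact: ae_eq_refl.
  move=> c f g /sum_carrier_integrable[mf If] /sum_carrier_integrable[mg Ig].
  rewrite avgop_lin//; exact: ae_eq_refl.
- by exists 1 => f Lf; rewrite mul1r; exact: avgop_Linfty.
- by exists 16 => f Gf; exact: avgop_Gspace.
by move=> C XT; exact: (XT _ Xh).1.
Qed.

(** * Quasi-concave envelopes of integer sequences and their peaks *)

(** kappa J is the maximum over i of n i - max (i - J, 0), that is,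
    2^(kappa J) is the maximum of 2^(n i) min (1, 2^J / 2^i). *)
Lemma envelope_exists (n : nat -> nat) :
  {homo n : i j / (i <= j)%N} ->
  (exists I, forall i, (I <= i)%N -> (n i <= i)%N) ->
  exists kappa : nat -> nat,
    (forall J i, (n i <= kappa J + (i - J))%N) /\
    (forall J, exists i, (kappa J + (i - J) <= n i)%N).
Proof.
move=> nh [I nI].
pose P J m := `[< exists i, (m + (i - J) <= n i)%N >].
have P0 J : exists m, P J m by exists 0; apply/asboolP; exists 0; lia.
have Pb J m : P J m -> (m <= I + J)%N.
  move=> /asboolP[i mi]; have [Ii|/ltnW iI] := leqP I i.
    by have := nI _ Ii; lia.
  by have := nh _ _ iI; have := nI _ (leqnn I); lia.
exists (fun J => ex_maxn (P0 J) (Pb J)); split=> [J i|J].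
  case: ex_maxnP => m _ max_m; have [h|h] := leqP (i - J) (n i); last lia.
  have /max_m : P J (n i - (i - J))%N by apply/asboolP; exists i; lia.
  lia.
by case: ex_maxnP => m /asboolP.
Qed.

Section envelope.
Variables (n kappa : nat -> nat).
Hypothesis nh : {homo n : i j / (i <= j)%N}.
Hypothesis n_small : forall B, exists I, forall i, (I <= i)%N -> (n i + B <= i)%N.
Hypothesis kappa_ge : forall J i, (n i <= kappa J + (i - J))%N.
Hypothesis kappa_att : forall J, exists i, (kappa J + (i - J) <= n i)%N.

Lemma envelope_step J : (kappa J <= kappa J.+1 <= (kappa J).+1)%N.
Proof.
have [i hi] := kappa_att J; have [i' hi'] := kappa_att J.+1.
by have := kappa_ge J.+1 i; have := kappa_ge J i'; lia.
Qed.

Lemma envelope_homo : {homo kappa : i j / (i <= j)%N}.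
Proof.
by apply: homo_leq => //; [exact: leq_trans|move=> i; case/andP: (envelope_step i)].
Qed.

(** Here the smallness of n, which comes from G and fails in the full Orlicz
    space, passes to the envelope. *)
Lemma envelope_small B : exists J, (kappa J + B <= J)%N.
Proof.
have [I nI] := n_small B; exists I.
have [i hi] := kappa_att I; have [Ii|/ltnW iI] := leqP I i.
  by have := nI _ Ii; lia.
by have := nI _ (leqnn I); have := nh iI; lia.
Qed.

(** In the coordinates 2^j, 2^(kappa j) the peaks are the corners where the
    piecewise linear envelope passes from slope of order 1 to a plateau. *)
Definition peak (j : nat) : bool :=
  (kappa j.+1 == kappa j) && ((j == 0)%N || (kappa j == (kappa j.-1).+1)).

(** If kappa pauses at J, the peak is the start of the plateau that contains J.
    If not, kappa increases by 1 from J on until it pauses, which must happen by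
    [envelope_small], and the peak is the point where it does. *)
Lemma peak_cover J : exists2 j, peak j & kappa j = (kappa J + (j - J))%N.
Proof.
have [flat|up] := eqVneq (kappa J.+1) (kappa J).
  have [|j /eqP jJ jmin] := @ex_minnP (fun j => kappa j == kappa J); first by exists J.
  have jJ' : (j <= J)%N by apply: jmin.
  exists j; last lia.
  rewrite /peak; apply/andP; split.
    move: jJ'; rewrite leq_eqVlt => /orP[/eqP->|ltjJ]; first exact/eqP.
    by have := envelope_homo ltjJ; have /andP[] := envelope_step j; lia.
  case: j jJ jmin jJ' => // j jJ jmin jJ'.
  have : kappa j != kappa J by apply/negP => /jmin; rewrite ltnn.
  by move=> kJ; apply/orP; right => /=; have /andP[] := envelope_step j; lia.
pose Q j := (J < j)%N && (kappa j.+1 == kappa j).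
have [|j /andP[Jj /eqP flat] jmin] := @ex_minnP Q.
  apply: contrapT => nQ.
  have grow j : (J <= j)%N -> kappa j = (kappa J + (j - J))%N.
    elim: j => [|j IH]; first by rewrite leqn0 => /eqP ->; lia.
    rewrite leq_eqVlt => /orP[/eqP<-|]; first lia.
    rewrite ltnS => Jj; have := IH Jj => kj.
    have : kappa j.+1 != kappa j.
      move: Jj; rewrite leq_eqVlt => /orP[/eqP<-//|ltJj].
      by apply/negP => h; apply: nQ; exists j; rewrite /Q ltJj.
    by have /andP[] := envelope_step j; lia.
  have [K hK] := envelope_small J.+1.
  have JK : (J <= K)%N by lia.
  by have := grow _ JK; lia.
have grow i : (J <= i <= j)%N -> kappa i = (kappa J + (i - J))%N.
  elim: i => [|i IH]; first by rewrite leqn0 => /andP[/eqP -> _]; lia.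
  move=> /andP[]; rewrite leq_eqVlt => /orP[/eqP<-|]; first lia.
  rewrite ltnS => Ji ij; have ki := IH; rewrite Ji ltnW// in ki.
  have := ki isT => {}ki.
  have : kappa i.+1 != kappa i.
    move: Ji; rewrite leq_eqVlt => /orP[/eqP<-//|ltJi].
    apply/negP => h; have := jmin i; rewrite /Q ltJi h => /(_ isT); lia.
  by have /andP[] := envelope_step i; lia.
exists j; last by apply: grow; lia.
rewrite /peak flat eqxx /=; apply/orP; right.
have -> : kappa j = (kappa J + (j - J))%N by apply: grow; lia.
have -> : kappa j.-1 = (kappa J + (j.-1 - J))%N by apply: grow; lia.
lia.
Qed.
Variable R : realType.

(** At a peak j > 0, where kappa j = kappa (j - 1) + 1, the right-hand side grows
    by 2^(kappa j), which is exactly the new summand. *)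
Lemma peak_head_sum J :
  \sum_(0 <= j < J.+1 | peak j) (2 ^+ kappa j : R) <= 2 * 2 ^+ kappa J.
Proof.
elim: J => [|J IH].
  rewrite big_mkcond big_nat1; have : 0 <= 2 ^+ kappa 0 :> R by rewrite exprn_ge0.
  by case: ifP => _; lra.
rewrite big_mkcond big_nat_recr//= -big_mkcond /=.
have hk : 2 ^+ kappa J <= 2 ^+ kappa J.+1 :> R.
  by rewrite ler_eXn2l ?ltr1n// envelope_homo.
case: ifP => [/andP[_ /= /eqP kJ]|_]; last by rewrite addr0; lra.
by rewrite kJ exprS; lra.
Qed.

(** After each peak 2^(kappa j) / 2^j is halved, so 2 (2^(kappa N) / 2^N)
    bounds the rest of the sum; the induction carries this term along. *)
Lemma peak_tail_sum J N :
  \sum_(J <= j < N | peak j) (2 ^+ kappa j / 2 ^+ j : R) <=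
  2 * (2 ^+ kappa J / 2 ^+ J).
Proof.
have pos j : 0 <= 2 ^+ kappa j / 2 ^+ j :> R by rewrite divr_ge0 ?exprn_ge0.
have [NJ|JN] := leqP N J; first by rewrite big_geq// mulr_ge0.
suff : \sum_(J <= j < N | peak j) (2 ^+ kappa j / 2 ^+ j : R) +
  2 * (2 ^+ kappa N / 2 ^+ N) <= 2 * (2 ^+ kappa J / 2 ^+ J).
  by have := pos N; lra.
elim: N JN => // N IH; rewrite ltnS => JN.
have step : (if peak N then 2 ^+ kappa N / 2 ^+ N else 0 : R) +
    2 * (2 ^+ kappa N.+1 / 2 ^+ N.+1) <= 2 * (2 ^+ kappa N / 2 ^+ N).
  have := pos N; have : 2 ^+ N.+1 = 2 * 2 ^+ N :> R by rewrite exprS.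
  move=> ->; rewrite invfM; case: ifP => [/andP[/eqP -> _]|_]; first lra.
  move=> _; have : 2 ^+ kappa N.+1 <= 2 * 2 ^+ kappa N :> R.
    by rewrite -exprS ler_eXn2l ?ltr1n//; case/andP: (envelope_step N).
  have : 0 < (2 ^+ N)^-1 :> R by rewrite invr_gt0 exprn_gt0.
  nra.
move: JN; rewrite leq_eqVlt => /orP[/eqP JN|JN].
  by rewrite JN big_mkcond big_nat1.
apply: le_trans (IH JN); rewrite big_mkcond [X in _ <= X + _]big_mkcond.
by rewrite big_nat_recr 1?ltnW//= -addrA lerD2l; exact: step.
Qed.

End envelope.

(** * The coefficients of the Rademacher sum *)

Lemma sum_blocks4 (R : realType) (F : nat -> R) (p q : nat) :
  \sum_(4 ^ p <= k < 4 ^ q) F (trunc_log 4 k) =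
  \sum_(p <= j < q) 3 * 4 ^+ j * F j.
Proof.
have [qp|] := leqP q p.
  by rewrite !big_geq// leq_pexp2l.
elim: q => // q IH; rewrite ltnS => pq.
rewrite (@big_cat_nat _ _ _ (4 ^ q)) ?leq_pexp2l//=.
rewrite [in RHS]big_nat_recr//=; congr (_ + _).
  by move: pq; rewrite leq_eqVlt => /orP[/eqP->|/IH//]; rewrite !big_geq.
rewrite (eq_big_nat _ _ (F2 := fun=> F q)); last first.
  by move=> k /andP[k1 k2]; rewrite (trunc_log_eq _ (n := q))// k1.
rewrite sumr_const_nat -[LHS]mulr_natl; congr (_ * _).
by rewrite expnS -[X in (_ - X)%N]mul1n -mulnBl natrM natrX.
Qed.

(** The index 0 is excluded because the function [rademacher 0] is 1 almost
    everywhere, so it is not a centered random variable. *)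
Definition rad_coef (R : realType) (kappa : nat -> nat) (k : nat) : R :=
  if (0 < k)%N && peak kappa (trunc_log 4 k)
  then 2 ^+ kappa (trunc_log 4 k) / 4 ^+ trunc_log 4 k else 0.

Lemma rad_coef_ge0 (R : realType) kappa k : 0 <= rad_coef R kappa k.
Proof. by rewrite /rad_coef; case: ifP => // _; rewrite divr_ge0// exprn_ge0. Qed.

Lemma rad_coef_sum (R : realType) kappa (m : nat) :
  \sum_(0 <= k < 4 ^ m) rad_coef R kappa k =
  3 * \sum_(0 <= j < m | peak kappa j) 2 ^+ kappa j.
Proof.
rewrite (@big_cat_nat _ _ _ 1) ?expn_gt0//= big_nat1 [X in X + _]/rad_coef ltnn add0r.
pose F j : R := if peak kappa j then 2 ^+ kappa j / 4 ^+ j else 0.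
rewrite (eq_big_nat _ _ (F2 := fun k => F (trunc_log 4 k))); last first.
  by move=> k /andP[k1 _]; rewrite /rad_coef /F k1.
rewrite -[X in \sum_(X <= _ < _) _](expn0 4) sum_blocks4 big_distrr [in RHS]big_mkcond.
apply: eq_bigr => j _; rewrite /F; case: ifP => _; last by rewrite mulr0.
by rewrite -mulrA; congr (_ * _); rewrite mulrCA mulfV ?mulr1// expf_neq0.
Qed.

Lemma rad_coef_sqr_sum (R : realType) kappa (p q : nat) :
  \sum_(4 ^ p <= k < 4 ^ q) rad_coef R kappa k ^+ 2 <=
  3 * (\sum_(p <= j < q | peak kappa j) 2 ^+ kappa j / 2 ^+ j) ^+ 2.
Proof.
pose F j : R := if peak kappa j then 2 ^+ kappa j / 4 ^+ j else 0.
rewrite (eq_big_nat _ _ (F2 := fun k => F (trunc_log 4 k) ^+ 2)); last first.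
  by move=> k /andP[k1 _]; rewrite /rad_coef /F (leq_trans _ k1)// expn_gt0.
rewrite (sum_blocks4 (fun j => F j ^+ 2)).
rewrite [in leRHS]big_mkcond.
apply: (@le_trans _ _ (3 * \sum_(p <= j < q)
   (if peak kappa j then 2 ^+ kappa j / 2 ^+ j else 0) ^+ 2)).
  rewrite big_distrr; apply: ler_sum => j _; rewrite /F /=.
  case: ifP => _; last by rewrite expr0n /= !mulr0.
  rewrite -mulrA; apply: ler_wpM2l => //; rewrite !expr_div_n.
  have -> : 4 ^+ j = (2 ^+ j) ^+ 2 :> R by rewrite sqr_pow2 natrX.
  rewrite mulrCA ler_wpM2l ?sqr_ge0//.
  rewrite [X in _ / X]expr2 invfM mulrA mulfV ?mul1r//.
rewrite ler_wpM2l//; apply: sum_sqr_le => j.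
by case: ifP => // _; rewrite divr_ge0 ?exprn_ge0.
Qed.

(** * Dyadic intervals and independence of the Rademacher functions *)

Definition dycell (R : realType) (n i : nat) : set R :=
  `]i%:R / 2 ^+ n, i.+1%:R / 2 ^+ n[%classic.
Arguments dycell : clear implicits.

Lemma dycellE (R : realType) (n i : nat) (t : R) :
  dycell R n i t = (i%:R < t * 2 ^+ n < i.+1%:R).
Proof.
rewrite /dycell/= in_itv/=.
by rewrite ltr_pdivrMr ?exprn_gt0// ltr_pdivlMr ?exprn_gt0.
Qed.

Lemma measurable_dycell (R : realType) n i : measurable (dycell R n i).
Proof. exact: measurable_itv. Qed.

Lemma mu01_dycell (R : realType) n i : (i < 2 ^ n)%N ->
  mu01 R (dycell R n i) = ((2 ^+ n)^-1)%:E.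
Proof.
move=> i2; rewrite mu01E setIidl; last first.
  move=> t; rewrite dycellE /= in_itv/= => /andP[it ti].
  have n0 : 0 < 2 ^+ n :> R by rewrite exprn_gt0.
  apply/andP; split; first by rewrite -(pmulr_lge0 _ n0) (le_trans _ (ltW it)).
  rewrite -(ler_pM2r n0) mul1r (le_trans (ltW ti))// -natrX ler_nat.
  by [].
rewrite lebesgue_measure_itv /= lte_fin ltr_pM2r ?invr_gt0 ?exprn_gt0// ltr_nat leqnn.
by rewrite -EFinB -mulrBl -natrB// subSnn mul1r.
Qed.

Lemma dycell_inj (R : realType) n i j (t : R) :
  dycell R n i t -> dycell R n j t -> i = j.
Proof.
rewrite !dycellE => /andP[i1 i2] /andP[j1 j2].
have : (i%:R : R) < j.+1%:R by exact: lt_trans j2.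
have : (j%:R : R) < i.+1%:R by exact: lt_trans i2.
rewrite !ltr_nat; lia.
Qed.

Lemma dycell_half (R : realType) n i : dycell R n.+1 i `<=` dycell R n i./2.
Proof.
move=> t; rewrite !dycellE exprS => /andP[h1 h2].
have e1 : (i./2%:R : R) * 2 <= i%:R by rewrite -natrM ler_nat; lia.
have e2 : (i.+1%:R : R) <= i./2.+1%:R * 2 by rewrite -natrM ler_nat; lia.
by apply/andP; split; nra.
Qed.

(** Nothing is asked at the endpoints of the dyadic intervals, because a
    Rademacher function vanishes at those where it changes sign. *)
Definition dyadic_val (R : realType) (n : nat) (F : R -> R) (v : nat -> R) :=
  forall i, (i < 2 ^ n)%N -> forall t, dycell R n i t -> F t = v i.

Lemma integral_dyadic (R : realType) (n : nat) (F : R -> R) (v : nat -> R) :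
  measurable_fun setT F -> (forall t, 0 <= F t) -> dyadic_val n F v ->
  (\int[mu01 R]_t (F t)%:E = ((2 ^+ n)^-1 * \sum_(0 <= i < 2 ^ n) v i)%:E)%E.
Proof.
move=> mF F0 Fv.
have tr : trivIset [set` iota 0 (2 ^ n)] (dycell R n).
  by move=> i j _ _ [t [ti tj]]; exact: dycell_inj ti tj.
have mD : measurable (\big[setU/set0]_(i <- iota 0 (2 ^ n)) dycell R n i).
  by apply: bigsetU_measurable => i _; exact: measurable_dycell.
set U := \big[setU/set0]_(i <- _) _ in mD *.
have sumU (f : R -> \bar R) : measurable_fun setT f -> (forall t, 0 <= f t)%E ->
    (\int[mu01 R]_(t in U) f t =
     \sum_(i <- iota 0 (2 ^ n)) \int[mu01 R]_(t in dycell R n i) f t)%E.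
  move=> mf f0; rewrite ge0_integral_bigsetU//;
    [by move=> i; exact: measurable_dycell|exact: iota_uniq|exact: measurable_funTS].
have muU : mu01 R U = 1%E.
  have := sumU (cst 1%E) (measurable_cst _) (fun=> lee01).
  rewrite integral_cst// mul1e => ->.
  rewrite (eq_big_seq (fun=> ((2 ^+ n)^-1)%:E)); last first.
    move=> i; rewrite mem_iota /= => i2; rewrite integral_cst ?mul1e ?mu01_dycell//.
    exact: measurable_dycell.
  rewrite sumEFin big_const_seq count_predT size_iota iter_addr_0 -[X in X%:E]mulr_natr.
  by rewrite natrX mulVf// expf_neq0.
have UC0 : mu01 R (~` U) = 0%E.
  have : mu01 R (U `|` ~` U) = (mu01 R U + mu01 R (~` U))%E.
    by rewrite measureU//; [exact: measurableC|rewrite setICr].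
  rewrite setUv mu01T muU.
  have := mu01_le1 (measurableC mD); have := measure_ge0 (mu01 R) (~` U).
  by case: (mu01 R (~` U)) => //= r; rewrite !lee_fin -EFinD => r0 _ [] ?; congr EFin; lra.
rewrite (@ge0_negligible_integral _ _ _ (mu01 R) setT (~` U))//; last 3 first.
- exact: measurableC.
- exact/measurable_EFinP.
- by move=> t _; rewrite lee_fin.
rewrite setTD setCK sumU//; [|exact/measurable_EFinP].
rewrite big_distrr -sumEFin /index_iota subn0; apply: eq_big_seq => i.
rewrite mem_iota /= => i2.
rewrite (eq_integral (cst (v i)%:E)); last first.
  by move=> t /set_mem ti /=; rewrite (Fv i i2).
rewrite integral_cst; last exact: measurable_dycell.
by rewrite [in LHS]mu01_dycell// -EFinM mulrC.
Qed.

Lemma sin_add_npi (R : realType) (y : R) (i : nat) :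
  sin (y + i%:R * pi) = (-1) ^+ i * sin y.
Proof.
elim: i => [|i IH]; first by rewrite mul0r addr0 expr0 mul1r.
by rewrite -natr1 mulrDl mul1r addrA sinDpi IH exprS; lra.
Qed.

Lemma rademacher_dycell (R : realType) (k i : nat) (t : R) :
  dycell R k i t -> rademacher k t = (-1) ^+ i.
Proof.
rewrite dycellE => /andP[h1 h2]; rewrite /rademacher.
have -> : 2 ^+ k * pi * t = (t * 2 ^+ k - i%:R) * pi + i%:R * pi :> R by ring.
rewrite sin_add_npi sgrM sgrX sgrN sgr1 [X in _ * X]gtr0_sg ?mulr1//.
apply: sin_gt0_pi; rewrite mulr_gt0 ?pi_gt0 ?subr_gt0//=.
rewrite -[ltRHS]mul1r ltr_pM2r ?pi_gt0// ltrBlDl.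
by rewrite natr1.
Qed.

Lemma measurable_sgr (R : realType) : measurable_fun setT (fun x : R => Num.sg x).
Proof.
rewrite (_ : (fun x : R => Num.sg x) = \1_(`]0%R, +oo[%classic) \- \1_(`]-oo, 0%R[%classic)).
  by apply: measurable_funB; apply: measurable_indic; exact: measurable_itv.
apply/funext => x /=; rewrite !indicE.
have -> : (x \in `]0%R, +oo[%classic) = (0 < x).
  by apply/idP/idP; [move/set_mem|move=> h; apply/mem_set]; rewrite /= in_itv/= andbT.
have -> : (x \in `]-oo, 0%R[%classic) = (x < 0).
  by apply/idP/idP; [move/set_mem|move=> h; apply/mem_set]; rewrite /= in_itv/=.
by case: (sgrP x) => h; rewrite ?h ?ltxx ?(lt_gtF h) /= ?mulr1n ?mulr0n ?sub0r ?subr0 ?subrr ?oppr0.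
Qed.

Lemma measurable_rademacher (R : realType) k : measurable_fun setT (@rademacher R k).
Proof.
apply: (measurableT_comp (@measurable_sgr R)).
apply: measurableT_comp.
  by apply: continuous_measurable_fun; exact: continuous_sin.
exact: measurable_funM.
Qed.

Lemma rademacher_le1 (R : realType) (k : nat) (t : R) : `|rademacher k t| <= 1.
Proof. by rewrite /rademacher normr_sg; case: (_ != 0). Qed.

Lemma sum_double_range (R : realType) (G : nat -> R) (m : nat) :
  \sum_(0 <= i < 2 * m) G i = \sum_(0 <= i < m) (G (2 * i)%N + G (2 * i).+1).
Proof.
elim: m => [|m IH]; first by rewrite muln0 !big_geq.
rewrite (_ : (2 * m.+1 = (2 * m).+2)%N); last lia.
by rewrite !big_nat_recr//= IH addrA.
Qed.

Lemma dyadic_val_step (R : realType) (n : nat) (F : R -> R) (v : nat -> R)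
    (Phi : R -> R -> R) : dyadic_val n F v ->
  dyadic_val n.+1 (fun t => Phi (F t) (rademacher n.+1 t))
    (fun i => Phi (v i./2) ((-1) ^+ i)).
Proof.
move=> Fv i i2 t ti; rewrite (rademacher_dycell ti).
by rewrite (Fv i./2 _ _ (dycell_half ti))//; move: i2; rewrite expnS; lia.
Qed.

(** Independence of F and of the Rademacher function n + 1, in the form needed
    below: F is constant on each dyadic interval of length 2^(-n), and on the two
    halves of such an interval that function is 1 and - 1. *)
Lemma rademacher_indep (R : realType) (n : nat) (F : R -> R)
    (Phi : R -> R -> R) : measurable_fun setT F -> (exists v, dyadic_val n F v) ->
  measurable_fun setT (fun t => Phi (F t) (rademacher n.+1 t)) ->
  (forall e, measurable_fun setT (fun t => Phi (F t) e)) ->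
  (forall t e, 0 <= Phi (F t) e) ->
  (\int[mu01 R]_t (Phi (F t) (rademacher n.+1 t))%:E =
   \int[mu01 R]_t ((Phi (F t) 1 + Phi (F t) (-1)) / 2)%:E)%E.
Proof.
move=> mF [v Fv] mP mPe P0.
rewrite (integral_dyadic mP _ (dyadic_val_step Phi Fv))//.
rewrite (@integral_dyadic R n _ (fun i => (Phi (v i) 1 + Phi (v i) (-1)) / 2)); first last.
- by move=> i i2 t ti; rewrite (Fv i i2 t ti).
- by move=> t; rewrite divr_ge0// addr_ge0.
- by apply: measurable_funM => //; apply: measurable_funD; exact: mPe.
congr EFin; rewrite expnS sum_double_range -mulr_suml exprS invfM.
rewrite (eq_bigr (fun i => Phi (v i) 1 + Phi (v i) (-1))); first by ring.
move=> i _; rewrite exprS mulN1r (_ : (2 * i)./2 = i); last lia.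
by rewrite (_ : (2 * i).+1./2 = i) ?exprM ?sqrrN ?expr1n//; lia.
Qed.

(** * A subgaussian maximal inequality *)

(** A crude form of the bound of cosh x by the exponential of x^2 / 2.  For
    x^2 <= 1/2 it follows from cosh x <= 1 / (1 - x^2), and for larger x from
    |x| <= 2 x^2. *)
Lemma cosh_le_expsq (R : realType) (x : R) :
  (expR x + expR (- x)) / 2 <= expR (2 * x ^+ 2).
Proof.
have [x2|x2] := leP (x ^+ 2) 2^-1; last first.
  have h1 : x <= 2 * x ^+ 2 by nra.
  have h2 : - x <= 2 * x ^+ 2 by nra.
  by rewrite -ler_expR in h1; rewrite -ler_expR in h2; lra.
have EE : expR x * expR (- x) = 1 by rewrite -expRD subrr expR0.
have E1 := expR_ge1Dx x; have E2 := expR_ge1Dx (- x).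
have E0 : 0 < expR x := expR_gt0 x; have E0' : 0 < expR (- x) := expR_gt0 (- x).
have x1 : -1 < x by nra. have x1' : x < 1 by nra.
apply: le_trans (expR_ge1Dx _).
have h1 : expR x * (1 - x) <= 1 by nra.
have h2 : expR (- x) * (1 + x) <= 1 by nra.
have h3 : expR x * (1 - x) * (1 + x) <= 1 + x by nra.
have h4 : expR (- x) * (1 + x) * (1 - x) <= 1 - x by nra.
have h5 : (expR x + expR (- x)) / 2 * (1 - x ^+ 2) <= 1 by lra.
have h6 : 1 <= (1 + 2 * x ^+ 2) * (1 - x ^+ 2) by nra.
have h7 : 0 < 1 - x ^+ 2 by lra.
by rewrite -(ler_pM2r h7); lra.
Qed.

(** The exponential martingale of the partial sums from index p + 1 on, stopped
    when the condition b holds.  With b a threshold it proves the maximal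
    inequality, with b constantly false it is the plain exponential. *)
Fixpoint frozen (R : realType) (b : R -> bool) (theta : R) (a : nat -> R)
    (p m : nat) (t : R) : R :=
  if m is m'.+1 then
    let z := frozen b theta a p m' t in
    if b z then z else z * expR (theta * a (p + m').+1 * rademacher (p + m').+1 t)
  else 1.

Lemma frozen_gt0 (R : realType) b theta (a : nat -> R) p m t :
  0 < frozen b theta a p m t.
Proof. by elim: m => //= m IH; case: ifP => // _; rewrite mulr_gt0// expR_gt0. Qed.

Lemma frozen_dyadic (R : realType) b theta (a : nat -> R) p m :
  exists v, dyadic_val (p + m) (frozen b theta a p m) v.
Proof.
elim: m => [|m [v IH]]; first by exists (fun=> 1).
rewrite addnS.
by eexists; apply: (dyadic_val_step
  (fun z e => if b z then z else z * expR (theta * a (p + m).+1 * e)) IH).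
Qed.

Lemma measurable_frozen (R : realType) b theta (a : nat -> R) p m :
  measurable_fun setT b -> measurable_fun setT (frozen b theta a p m).
Proof.
move=> mb; elim: m => [|m IH] /=; first exact: measurable_cst.
apply: measurable_fun_ifT => //; first exact: measurableT_comp.
apply: measurable_funM => //; apply: measurableT_comp => //.
by apply: measurable_funM => //; exact: measurable_rademacher.
Qed.

(** At each step the integral is multiplied by at most the bound of
    [cosh_le_expsq]: the part where the process moves gains a factor cosh, and
    the stopped part is unchanged. *)
Lemma frozen_int_le (R : realType) b theta (a : nat -> R) p m :
  measurable_fun setT b ->
  (\int[mu01 R]_t (frozen b theta a p m t)%:E <=
   (expR (2 * theta ^+ 2 * \sum_(p.+1 <= k < (p + m).+1) a k ^+ 2))%:E)%E.
Proof.
move=> mb; elim: m => [|m IH].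
  by rewrite addn0 big_geq// mulr0 expR0 (eq_integral (cst 1%E))// integral_cst// mul1e mu01T.
set c := theta * a (p + m).+1.
have mF := measurable_frozen theta a p m mb.
rewrite addnS big_nat_recr ?ltnS ?leq_addr//.
pose Phi z e : R := if b z then z else z * expR (c * e).
have F0 t := ltW (frozen_gt0 b theta a p m t).
have mP e : measurable_fun setT (fun t => Phi (frozen b theta a p m t) e).
  by apply: measurable_fun_ifT => //; [exact: measurableT_comp|exact: measurable_funM].
have -> := @rademacher_indep R (p + m) _ Phi mF (frozen_dyadic _ _ _ _ _)
   (measurable_frozen theta a p m.+1 mb) mP _; last first.
  by move=> t e; rewrite /Phi; case: ifP => _ //; rewrite mulr_ge0 ?expR_ge0.
set E := expR (2 * theta ^+ 2 * a (p + m).+1 ^+ 2).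
apply: (@le_trans _ _ (\int[mu01 R]_t (E%:E * (frozen b theta a p m t)%:E))%E).
  apply: ge0_le_integral => //.
  - move=> t _; rewrite lee_fin divr_ge0// addr_ge0// /Phi;
      by case: ifP => _ //; rewrite mulr_ge0 ?expR_ge0.
  - apply/measurable_EFinP; apply: measurable_funM => //.
    by apply: measurable_funD; exact: mP.
  - by apply: measurable_funeM; exact/measurable_EFinP.
  - move=> t _; rewrite -EFinM lee_fin /Phi.
    have E1 : 1 <= E by rewrite -[leLHS]expR0 ler_expR mulr_ge0 ?sqr_ge0// mulr_ge0 ?sqr_ge0.
    have := F0 t; set z := frozen _ _ _ _ _ _ => z0.
    case: ifP => _; first by nra.
    have := cosh_le_expsq c; rewrite {3}/c exprMn mulrA -/E mulr1 mulrN1 => h.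
    by rewrite -mulrDr -mulrA mulrC ler_wpM2r.
rewrite ge0_integralZl//; first last.
- by rewrite lee_fin expR_ge0.
- by move=> t _; rewrite lee_fin; exact: F0.
- exact/measurable_EFinP.
rewrite /= mulrDr expRD mulrC EFinM; apply: lee_wpmul2l => //.
by rewrite lee_fin expR_ge0.
Qed.

Definition rad_incr (R : realType) (a : nat -> R) (p m : nat) (t : R) : R :=
  \sum_(p.+1 <= k < (p + m).+1) a k * rademacher k t.

Lemma rad_incr0 (R : realType) (a : nat -> R) p t : rad_incr a p 0 t = 0.
Proof. by rewrite /rad_incr addn0 big_geq. Qed.

Lemma rad_incrS (R : realType) (a : nat -> R) p m t :
  rad_incr a p m.+1 t = rad_incr a p m t + a (p + m).+1 * rademacher (p + m).+1 t.
Proof. by rewrite /rad_incr addnS big_nat_recr//= ltnS leq_addr. Qed.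

Lemma rad_incrN (R : realType) (a : nat -> R) p m t :
  rad_incr (fun k => - a k) p m t = - rad_incr a p m t.
Proof. by rewrite /rad_incr -sumrN; apply: eq_bigr => k _; rewrite mulNr. Qed.

Lemma measurable_rad_incr (R : realType) (a : nat -> R) p m :
  measurable_fun setT (rad_incr a p m).
Proof.
by apply: measurable_sum => k; apply: measurable_funM => //; exact: measurable_rademacher.
Qed.

(** Once a partial sum exceeds s the process exceeds expR (theta s) and stays
    there; before that it is the exponential of the partial sum. *)
Lemma frozen_crossing (R : realType) (theta s : R) (a : nat -> R) p m t :
  0 < theta ->
  expR (theta * s) < frozen (fun z => expR (theta * s) < z) theta a p m t \/
  (frozen (fun z => expR (theta * s) < z) theta a p m t =
     expR (theta * rad_incr a p m t) /\
   forall i, (i <= m)%N -> rad_incr a p i t <= s).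
Proof.
move=> th0; elim: m => [|m [IH|[IH IHs]]] /=.
- case: ltP => h; [by left|right].
  rewrite rad_incr0 mulr0 expR0; split=> // i; rewrite leqn0 => /eqP ->.
  by move: h; rewrite -[X in X <= _]expR0 ler_expR pmulr_rge0// rad_incr0.
- by left; rewrite IH.
rewrite IH ltr_expR ltr_pM2l// [s < _]ltNge IHs//= -expRD -mulrA -mulrDr -rad_incrS.
rewrite ltr_expR ltr_pM2l//; case: ltP => h; [by left|right].
split=> // i; rewrite leq_eqVlt => /orP[/eqP->//|]; exact: IHs.
Qed.

Lemma rad_incr_max_finite (R : realType) (theta s V : R) (a : nat -> R) p m :
  0 < theta -> (forall n, \sum_(p.+1 <= k < n) a k ^+ 2 <= V) ->
  (mu01 R (\bigcup_(i in [set i | (i <= m)%N]) [set t | (s < rad_incr a p i t)%R])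
     <= (expR (2 * theta ^+ 2 * V - theta * s))%:E)%E.
Proof.
move=> th0 aV.
set b := fun z : R => expR (theta * s) < z.
have mb : measurable_fun setT b by apply: measurable_fun_ltr.
have mF := measurable_frozen theta a p m mb.
pose A := [set t : R | b (frozen b theta a p m t)].
have mA : measurable A.
  rewrite (_ : A = (b \o frozen b theta a p m) @^-1` [set true])//.
  rewrite -[X in measurable X]setTI; exact: (measurableT_comp mb mF).
have mS i : measurable [set t : R | (s < rad_incr a p i t)%R].
  by apply: measurable_gt; exact: measurable_rad_incr.
apply: (@le_trans _ _ (mu01 R A)).
  apply: le_measure; rewrite ?inE//; first by apply: bigcup_measurable => i _; exact: mS.
  move=> t [i /= im si]; have [//|[_ h]] := @frozen_crossing R theta s a p m t th0.
  by move: si; rewrite ltNge h.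
have muA : (mu01 R A = (fine (mu01 R A))%:E).
  by rewrite fineK// ge0_fin_numE// (le_lt_trans (mu01_le1 mA))// ltry.
rewrite expRD expRN muA lee_fin ler_pdivlMr ?expR_gt0// -lee_fin mulrC EFinM -muA.
rewrite -integral_cst//.
apply: (@le_trans _ _ (\int[mu01 R]_t (frozen b theta a p m t)%:E)%E); last first.
  apply: (le_trans (frozen_int_le theta a p m mb)).
  by rewrite lee_fin ler_expR ler_wpM2l// mulr_ge0 ?sqr_ge0.
apply: (@le_trans _ _ (\int[mu01 R]_(t in A) (frozen b theta a p m t)%:E)%E).
  apply: ge0_le_integral => //.
  - by move=> t _; rewrite lee_fin expR_ge0.
  - exact/measurable_EFinP/measurable_funTS.
  - by move=> t /= /ltW; rewrite lee_fin.
apply: ge0_subset_integral => //; first exact/measurable_EFinP.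
by move=> t _; rewrite lee_fin ltW// frozen_gt0.
Qed.

(** Markov inequality for the stopped process, with theta = s / (4 V), which
    minimizes 2 theta^2 V - theta s; the factor 2 accounts for both signs. *)
Lemma rad_incr_max (R : realType) (s V : R) (a : nat -> R) p :
  0 < s -> 0 < V -> (forall n, \sum_(p.+1 <= k < n) a k ^+ 2 <= V) ->
  measurable (\bigcup_i [set t | (s < `|rad_incr a p i t|)%R]) /\
  (mu01 R (\bigcup_i [set t | (s < `|rad_incr a p i t|)%R])
     <= (2 * expR (- (s ^+ 2 / (8 * V))))%:E)%E.
Proof.
move=> s0 V0 aV.
have mS (c : nat -> R) i : measurable [set t : R | (s < rad_incr c p i t)%R].
  by apply: measurable_gt; exact: measurable_rad_incr.
have mabs i : measurable [set t : R | (s < `|rad_incr a p i t|)%R].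
  by apply: measurable_abs_gt; exact: measurable_rad_incr.
split; first exact: bigcup_measurable.
pose U (c : nat -> R) m := \bigcup_(i in [set i | (i <= m)%N]) [set t : R | (s < rad_incr c p i t)%R].
have mU c m : measurable (U c m) by apply: bigcup_measurable => i _; exact: mS.
pose a' k := - a k.
pose W m := U a m `|` U a' m.
have mW m : measurable (W m) by exact: measurableU.
have Wb m : (mu01 R (W m) <= (2 * expR (- (s ^+ 2 / (8 * V))))%:E)%E.
  have th0 : 0 < s / (4 * V) by rewrite divr_gt0// mulr_gt0.
  have e : 2 * (s / (4 * V)) ^+ 2 * V - (s / (4 * V)) * s = - (s ^+ 2 / (8 * V)).
    by field; rewrite gt_eqF.
  apply: (@le_trans _ _ (mu01 R (U a m) + mu01 R (U a' m))%E); first by apply: measureU2; exact: mU.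
  rewrite mulr_natl mulr2n EFinD -e; apply: leeD; apply: rad_incr_max_finite => //.
  by move=> n; under eq_bigr do rewrite sqrrN; exact: aV.
have Wh : nondecreasing_seq W.
  move=> m n mn; apply/subsetPset; apply: setUSS; move=> t [i /= im si];
    by exists i => //=; exact: leq_trans mn.
rewrite (_ : \bigcup_i _ = \bigcup_m W m); last first.
  apply/seteqP; split=> t.
    move=> [i _ /=]; rewrite ltr_normr => /orP[h|h]; exists i => //.
      by left; exists i => /=.
    by right; exists i => //=; rewrite rad_incrN.
  move=> [m _ [[i _ h]|[i _ h]]]; exists i => //=; rewrite ltr_normr; first by rewrite h.
  by move: h; rewrite /= rad_incrN => ->; rewrite orbT.
have cW : (mu01 R \o W) @ \oo --> mu01 R (\bigcup_m W m).
  apply: nondecreasing_cvg_mu; [exact: mW| |exact: Wh].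
  by apply: bigcup_measurable => m _; exact: mW.
rewrite -(cvg_lim _ cW)//; apply: lime_le; first by apply/cvg_ex; eexists; exact: cW.
by apply: nearW => m; exact: Wb.
Qed.

(** * Convergence, measurability and tails of Rademacher series *)

Lemma l2_tail (R : realType) (a : nat -> R) (e : R) : l2 a -> 0 < e ->
  exists p, forall n, \sum_(p.+1 <= k < n) a k ^+ 2 <= e.
Proof.
move=> la e0; pose u k := a k ^+ 2.
have u0 k : 0 <= u k by exact: sqr_ge0.
have nd : nondecreasing_seq (series u).
  by apply: nondecreasing_series => k _ _; exact: u0.
have [p pe] : exists p, limn (series u) - e < series u p.
  have : limn (series u) - e < limn (series u) by rewrite ltrBlDr ltrDl.
  move=> /(@cvgr_gt _ _ _ _ _ _ la) [p _ hp]; exists p; exact: hp (leqnn p).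
exists p => n; have [np|pn] := leqP n p.+1; first by rewrite big_geq// ltW.
have := nondecreasing_cvgn_le nd la n.
have : series u p <= series u p.+1 by apply: nd.
have : series u n = series u p.+1 + \sum_(p.+1 <= k < n) a k ^+ 2.
  by rewrite /series/= (@big_cat_nat _ _ _ p.+1)//= ltnW.
by move: pe; lra.
Qed.

Lemma series_rad_incr (R : realType) (a : nat -> R) (p m : nat) (t : R) :
  series (fun k => a k * rademacher k t) (p + m).+1 =
  series (fun k => a k * rademacher k t) p.+1 + rad_incr a p m t.
Proof.
by rewrite /series/= (@big_cat_nat _ _ _ p.+1)//= ltnS leq_addr.
Qed.

Lemma expRN_small (R : realType) (s e : R) : 0 < s -> 0 < e ->
  exists2 V, 0 < V & 2 * expR (- (s ^+ 2 / (8 * V))) <= e.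
Proof.
move=> s0 e0; exists (e * s ^+ 2 / 16).
  by rewrite divr_gt0// mulr_gt0// exprn_gt0.
have -> : s ^+ 2 / (8 * (e * s ^+ 2 / 16)) = 2 / e.
  by field; rewrite !gt_eqF.
rewrite expRN -ler_pdivlMl// -[leRHS]invrK lef_pV2 ?posrE ?expR_gt0 ?invr_gt0 ?mulr_gt0 ?invr_gt0//.
apply: le_trans (expR_ge1Dx _); rewrite invfM invrK; lra.
Qed.

(** By the maximal inequality the oscillation of the partial sums beyond p
    exceeds any fixed bound only on a set whose measure tends to 0 with p, so
    almost everywhere the partial sums form a Cauchy sequence. *)
Lemma rademacher_series_cvg (R : realType) (a : nat -> R) : l2 a ->
  {ae mu01 R, forall t, cvgn (series (fun k => a k * rademacher k t))}.
Proof.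
move=> la.
pose W (q p : nat) := \bigcup_i [set t : R | (q.+1%:R^-1 < `|rad_incr a p i t|)%R].
have mW q p : measurable (W q p).
  apply: bigcup_measurable => i _; apply: measurable_abs_gt; exact: measurable_rad_incr.
pose B q := \bigcap_p W q p.
have mB q : measurable (B q) by apply: bigcap_measurable => //; exists 0.
have B0 q : (mu01 R).-negligible (B q).
  exists (B q); split; [exact: mB| |by []].
  apply/eqP; rewrite eq_le measure_ge0 andbT.
  apply/lee_addgt0Pr => e e0; rewrite add0e.
  have q0 : 0 < q.+1%:R^-1 :> R by rewrite invr_gt0.
  have [V V0 Ve] := expRN_small q0 e0.
  have [p pV] := l2_tail la V0.
  apply: (@le_trans _ _ (mu01 R (W q p))).
    by apply: le_measure; rewrite ?inE; [exact: mB|exact: mW|move=> t; apply].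
  by apply: (le_trans (rad_incr_max q0 V0 pV).2); rewrite lee_fin.
apply: negligibleS (negligible_bigcup B0) => t /= nc.
apply: contrapT => nB; apply: nc; apply/cauchy_cvgP/cauchy_seriesP => e e0.
have [q qe] : exists q, q.+1%:R^-1 * 2 < e.
  exists (Num.truncn (2 / e)); rewrite mulrC ltr_pdivrMr// mulrC -ltr_pdivrMr//.
  exact: truncnS_gt.
have [p hp] : exists p, forall i, `|rad_incr a p i t| <= q.+1%:R^-1.
  apply: contrapT => h; apply: nB; exists q => // p _.
  apply: contrapT => hW; apply: h; exists p => i.
  by rewrite leNgt; apply/negP => hi; apply: hW; exists i.
have key m n : (p < m)%N -> (p < n)%N ->
    `|\sum_(m <= k < n) a k * rademacher k t| < e.
  move=> pm pn; have [nm|mn] := leqP n m; first by rewrite big_geq// normr0.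
  have -> : \sum_(m <= k < n) a k * rademacher k t =
      rad_incr a p (n - p.+1) t - rad_incr a p (m - p.+1) t.
    rewrite /rad_incr -!addSn !subnKC// [in RHS](@big_cat_nat _ _ _ m)//=; last exact: ltnW.
    by rewrite [X in _ = X]addrC addKr.
  by apply: (le_lt_trans (ler_normB _ _)); move: qe (hp (n - p.+1)%N) (hp (m - p.+1)%N); move: (q.+1%:R^-1) => c; lra.
exists ([set n | (p < n)%N], [set n | (p < n)%N]); first by split; exists p.+1.
by move=> [m n] [/= pm pn]; exact: key.
Qed.

(** The set of convergence is measurable by the Cauchy criterion, and [limn] is
    constant off it. *)
Lemma measurable_limn (R : realType) (u : nat -> R -> R) :
  (forall n, measurable_fun setT (u n)) ->
  measurable_fun setT (fun t => limn (fun n => u n t)).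
Proof.
move=> mu.
pose C := [set t : R | cvgn (fun n => u n t)].
have CE : C = \bigcap_q \bigcup_p \bigcap_i
    ~` [set t : R | (q.+1%:R^-1 < `|u (p + i)%N t - u p t|)%R].
  apply/seteqP; split=> t.
    move=> /= ct q _.
    have q0 : 0 < q.+1%:R^-1 / 2 :> R by rewrite divr_gt0// invr_gt0.
    have : \forall n \near \oo, `|u n t - limn (fun n => u n t)| < q.+1%:R^-1 / 2.
      by apply: cvgr_distC_lt => //; exact: ct.
    move=> [p _ hp].
    exists p => // i _ /=; apply/negP; rewrite -leNgt.
    have := hp p (leqnn p); have := hp (p + i)%N (leq_addr _ _) => /=.
    set l := limn _; move: (q.+1%:R^-1) => c h1 h2.
    rewrite (_ : _ - _ = (u (p + i)%N t - l) - (u p t - l)); last by ring.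
    by apply: (le_trans (ler_normB _ _)); lra.
  move=> h /=; apply/cauchy_cvgP/cauchyP => e e0.
  have [q qe] : exists q, q.+1%:R^-1 < e.
    exists (Num.truncn e^-1); rewrite invf_plt ?posrE//.
    exact: truncnS_gt.
  have [p _ hp] := h q Logic.I; exists (u p t); exists p => // n /= pn.
  have := hp (n - p)%N Logic.I => /= /negP; rewrite -leNgt subnKC//.
  by move=> hn; rewrite /ball/= distrC (le_lt_trans hn).
have mC : measurable C.
  rewrite CE; apply: bigcap_measurable => [|q _]; first by exists 0.
  apply: bigcup_measurable => p _; apply: bigcap_measurable => [|i _]; first by exists 0.
  apply: measurableC; apply: (@measurable_abs_gt R (u (p + i)%N \- u p)).
  exact: measurable_funB.
rewrite -(setUv C); apply/measurable_funU => //; first exact: measurableC.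
split; first by apply: (measurable_fun_cvg (h := u)) => // n; exact: measurable_funTS.
apply: (eq_measurable_fun (cst (point : R))) => //.
by move=> t /set_mem /= nc; rewrite dvgP.
Qed.

Lemma measurable_rademacher_sum (R : realType) (a : nat -> R) :
  measurable_fun setT (rademacher_sum a).
Proof.
apply: measurable_limn => n; apply: measurable_sum => k.
by apply: measurable_funM => //; exact: measurable_rademacher.
Qed.

(** The first p + 1 terms are bounded by the l1 norm of their coefficients, the
    rest by the maximal inequality. *)
Lemma rademacher_sum_tail (R : realType) (a : nat -> R) (p : nat) (H s V : R) :
  l2 a -> 0 < s -> 0 < V -> (forall n, \sum_(p.+1 <= k < n) a k ^+ 2 <= V) ->
  \sum_(0 <= k < p.+1) `|a k| <= H ->
  (tailm (rademacher_sum a) (H + s) <= (2 * expR (- (s ^+ 2 / (8 * V))))%:E)%E.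
Proof.
move=> la s0 V0 aV aH.
have [mW Wb] := rad_incr_max s0 V0 aV.
have [N [mN N0 hN]] := rademacher_series_cvg la.
apply: le_trans Wb; set W := \bigcup_i _ in mW *.
rewrite -[leRHS]adde0 -[X in (_ + X)%E]N0.
apply: (@le_trans _ _ (mu01 R (W `|` N))); last exact: measureU2.
apply: le_measure; rewrite ?inE; [|by apply: measurableU|].
  by apply: measurable_abs_gt; exact: measurable_rademacher_sum.
move=> t /= gt; apply: contrapT => /not_orP[nW nN].
have ct : cvgn (series (fun k => a k * rademacher k t)).
  by apply: contrapT => h; apply: nN; apply: hN.
have hi m : `|rad_incr a p m t| <= s.
  by rewrite leNgt; apply/negP => hm; apply: nW; exists m.
have : `|rademacher_sum a t| <= H + s; last by rewrite leNgt gt.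
apply: (cvgr_to_le (cvg_norm ct)); exists p.+1 => // n /= pn.
rewrite -(subnKC pn) addSn series_rad_incr; apply: (le_trans (ler_normD _ _)).
apply: lerD (hi _); apply: le_trans aH; apply: (le_trans (ler_norm_sum _ _ _)).
apply: ler_sum => k _; rewrite normrM -[leRHS]mulr1 ler_wpM2l//.
exact: rademacher_le1.
Qed.

(** * Averages of a Rademacher sum over initial dyadic intervals *)

(** From |y| <= expR y + expR (- y) and the exponential moments, after scaling
    by v. *)
Lemma rad_incr_L1 (R : realType) (a : nat -> R) (p m : nat) (v : R) :
  0 < v -> (forall n, \sum_(p.+1 <= k < n) a k ^+ 2 <= v ^+ 2) ->
  (\int[mu01 R]_t `|rad_incr a p m t|%:E <= (v * (2 * expR 2))%:E)%E.
Proof.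
move=> v0 aV; pose b := fun _ : R => false.
have mb : measurable_fun setT b by exact: measurable_cst.
have frozenE theta t : frozen b theta a p m t = expR (theta * rad_incr a p m t).
  elim: m => [|m IH] /=; first by rewrite rad_incr0 mulr0 expR0.
  by rewrite IH rad_incrS mulrDr expRD mulrA.
have expI theta : theta ^+ 2 * v ^+ 2 = 1 ->
    (\int[mu01 R]_t (expR (theta * rad_incr a p m t))%:E <= (expR 2)%:E)%E.
  move=> thv; under eq_integral do rewrite -frozenE.
  apply: (le_trans (frozen_int_le theta a p m mb)).
  rewrite lee_fin ler_expR -mulrA.
  by have := ler_wpM2l (sqr_ge0 theta) (aV (p + m).+1); rewrite thv; lra.
have vV : (v^-1) ^+ 2 * v ^+ 2 = 1 by rewrite -exprMn mulVf ?gt_eqF// expr1n.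
have mE theta : measurable_fun setT (fun t => (expR (theta * rad_incr a p m t))%:E).
  apply/measurable_EFinP; apply: measurableT_comp => //.
  by apply: measurable_funM => //; exact: measurable_rad_incr.
apply: (@le_trans _ _ (\int[mu01 R]_t (v%:E * ((expR (v^-1 * rad_incr a p m t))%:E +
    (expR (- v^-1 * rad_incr a p m t))%:E)))%E).
  apply: ge0_le_integral => //.
  - apply/measurable_EFinP; apply: measurableT_comp => //; exact: measurable_rad_incr.
  - by apply: measurable_funeM; apply: emeasurable_funD; exact: mE.
  - move=> t _; rewrite -EFinD -EFinM lee_fin -ler_pdivrMl//.
    set y := rad_incr _ _ _ _.
    rewrite -[X in X * _]gtr0_norm ?invr_gt0// -normrM mulNr.
    move: (v^-1 * y) => z; have := expR_ge1Dx z; have := expR_ge1Dx (- z).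
    have := expR_gt0 z; have := expR_gt0 (- z).
    by case: (lerP 0 z) => z0; [rewrite ger0_norm//|rewrite ltr0_norm//]; lra.
rewrite ge0_integralZl//; first last.
- by rewrite lee_fin ltW.
- by move=> t _; rewrite -EFinD lee_fin addr_ge0// expR_ge0.
- by apply: emeasurable_funD; exact: mE.
rewrite ge0_integralD//; first last.
- exact: mE.
- exact: mE.
rewrite EFinM; apply: lee_wpmul2l; first by rewrite lee_fin ltW.
rewrite mulr_natl mulr2n EFinD; apply: leeD; apply: expI => //.
by rewrite sqrrN.
Qed.

(** Fatou lemma transfers [rad_incr_L1] to the limit. *)
Lemma rademacher_sum_L1 (R : realType) (a : nat -> R) (p : nat) (v : R) :
  l2 a -> 0 < v -> (forall n, \sum_(p.+1 <= k < n) a k ^+ 2 <= v ^+ 2) ->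
  (\int[mu01 R]_t `|rademacher_sum a t -
      series (fun k => a k * rademacher k t) p.+1|%:E <= (v * (2 * expR 2))%:E)%E.
Proof.
move=> la v0 aV.
pose f (m : nat) (t : R) : \bar R := `|rad_incr a p m t|%:E.
have mf m : measurable_fun setT (f m).
  by apply/measurable_EFinP; apply: measurableT_comp => //; exact: measurable_rad_incr.
have mS : measurable_fun setT (fun t => series (fun k => a k * rademacher k t) p.+1).
  apply: measurable_sum => k.
  by apply: measurable_funM => //; exact: measurable_rademacher.
apply: (@le_trans _ _ (\int[mu01 R]_t limn_einf (f ^~ t))%E).
  apply: ae_ge0_le_integral => //.
  - apply/measurable_EFinP; apply: measurableT_comp => //.
    by apply: measurable_funB => //; exact: measurable_rademacher_sum.
  - move=> t _; rewrite limn_einf_lim; apply: lime_ge; first exact: is_cvg_einfs.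
    by apply: nearW => n; apply: le_ereal_inf_tmp => _ [k _ <-]; rewrite lee_fin.
  - apply: (eq_measurable_fun (fun t => - limn_esup (fun m => - f m t))%E).
      by move=> t _ /=; have := limn_esupN (f ^~ t); rewrite /comp => ->; rewrite oppeK.
    apply: measurableT_comp => //; apply: measurable_fun_limn_esup => m.
    exact: measurableT_comp.
  - apply: ae01_imp (rademacher_series_cvg la) => t ct _.
    suff h : f m t @[m --> \oo] --> `|rademacher_sum a t -
        series (fun k => a k * rademacher k t) p.+1|%:E.
      by rewrite (cvg_limn_einf_sup h).1.
    apply: cvg_EFin; first exact: nearW.
    apply: cvg_norm.
    rewrite (_ : (fun m => rad_incr a p m t) = fun m => series (fun k => a k * rademacher k t) (m + p.+1)%N -
      series (fun k => a k * rademacher k t) p.+1); last first.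
      by apply/funext => m; rewrite addnC addSn series_rad_incr addrAC subrr add0r.
    apply: cvgB; last exact: cvg_cst.
    by rewrite (cvg_shiftn p.+1 (series (fun k => a k * rademacher k t))).
apply: (le_trans (fatou (mu01 R) measurableT mf _)); first by move=> m t _; rewrite lee_fin.
rewrite limn_einf_lim; apply: lime_le; first exact: is_cvg_einfs.
apply: nearW => n; apply: ge_ereal_inf.
by exists (\int[mu01 R]_t f n t)%E; [exists n => /=|exact: rad_incr_L1].
Qed.

Lemma rademacher_Linfty (R : realType) (k : nat) : carrier (Linfty R) (@rademacher R k).
Proof.
apply/LinftyP; split; first exact: measurable_rademacher.
by exists 1; apply: aeW => t; exact: rademacher_le1.
Qed.

Lemma series_rademacher_integrable (R : realType) (a : nat -> R) n :
  (mu01 R).-integrable setT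
    (EFin \o (fun t => series (fun k => a k * rademacher k t) n)).
Proof.
apply: Linfty_integrable; apply/LinftyP; split.
  apply: measurable_sum => k.
  by apply: measurable_funM => //; exact: measurable_rademacher.
exists (\sum_(0 <= k < n) `|a k|); apply: aeW => t /=.
apply: (le_trans (ler_norm_sum _ _ _)); apply: ler_sum => k _.
by rewrite normrM -[leRHS]mulr1 ler_wpM2l// rademacher_le1.
Qed.

Lemma mu01_dycell0 (R : realType) (M : nat) :
  mu01 R (dycell R M 0) = ((2 ^+ M)^-1)%:E.
Proof. by rewrite mu01_dycell// expn_gt0. Qed.

(** For k > M the function is independent of the indicator of the interval and
    has mean 0. *)
Lemma avg_rademacher (R : realType) (M k : nat) :
  avg (dycell R M 0) (@rademacher R k) = (k <= M)%:R.
Proof.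
have mE := @measurable_dycell R M 0.
have E0 : (2 ^+ M)^-1 != 0 :> R by rewrite invr_eq0 expf_neq0.
have Ir := Linfty_integrable (rademacher_Linfty R k).
rewrite /avg mu01_dycell0 /=; have [kM|Mk] := leqP k M.
  rewrite (@eq_Rintegral _ _ _ _ _ (cst 1)).
    by rewrite Rintegral_cst// mul1r mu01_dycell0/= mulVf.
  move=> t /set_mem; rewrite dycellE => /andP[t0 t1] /=.
  rewrite (@rademacher_dycell R k 0 t) ?expr0//; rewrite dycellE.
  have tk : t * 2 ^+ k <= t * 2 ^+ M.
    rewrite ler_wpM2l// ?ler_eXn2l ?ltr1n//.
    by move: t0; rewrite pmulr_lgt0 ?exprn_gt0// => /ltW.
  rewrite (le_lt_trans tk t1) andbT.
  by move: t0; rewrite !pmulr_lgt0 ?exprn_gt0.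
case: k Mk Ir => // k Mk Ir; rewrite ltnS in Mk.
pose F : R -> R := \1_(dycell R M 0).
have mF : measurable_fun setT F by exact: measurable_indic.
(* The maximum makes Phi nonnegative for every e, and it is 1 + e on the values
   taken by the Rademacher functions. *)
pose Phi (x e : R) : R := x * Num.max (1 + e) 0.
have Fk : exists v, dyadic_val k F v.
  elim: k Mk {Ir} => [|k IH].
    rewrite leqn0 => /eqP M0; exists (fun=> 1); rewrite /F M0.
    move=> i; rewrite expn0 ltnS leqn0 => /eqP -> t ti.
    by rewrite indicE mem_set.
  rewrite leq_eqVlt => /orP[/eqP <-|]; last first.
    rewrite ltnS => /IH [v Fv]; eexists.
    exact: (dyadic_val_step (fun x _ => x) Fv).
  exists (fun i => (i == 0)%:R) => i i2 t ti; rewrite /F indicE; congr ((nat_of_bool _)%:R).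
  apply/idP/idP => [/set_mem t0|/eqP i0]; first by rewrite (dycell_inj ti t0).
  by apply/mem_set; move: ti; rewrite i0.
have F0 t : 0 <= F t by rewrite /F indicE.
have max_rad t : Num.max (1 + rademacher k.+1 t) 0 = 1 + rademacher k.+1 t.
  apply/max_idPl; have := rademacher_le1 k.+1 t; rewrite ler_norml; lra.
have := @rademacher_indep R k F Phi mF Fk _ _ _.
have mPr : measurable_fun setT (fun t => Phi (F t) (rademacher k.+1 t)).
  apply: measurable_funM => //; under eq_fun do rewrite max_rad.
  by apply: measurable_funD => //; exact: measurable_rademacher.
move=> /(_ mPr) H.
have {H} : (\int[mu01 R]_t (F t * (1 + rademacher k.+1 t))%:E = \int[mu01 R]_t (F t)%:E)%E.
  under eq_integral do rewrite -max_rad.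
  rewrite H.
  - apply: eq_integral => t _; congr EFin; rewrite /Phi.
    rewrite (max_idPl _) ?(max_idPl _); lra.
  - by move=> e; exact: measurable_funM.
  - by move=> t e; rewrite mulr_ge0// le_max lexx orbT.
move=> H.
have IF : (mu01 R).-integrable (dycell R M 0) (EFin \o cst 1).
  apply: (@integrableS _ _ _ _ setT) => //; apply: Linfty_integrable.
  by apply/LinftyP; split => //; exists 1; apply: aeW => t /=; rewrite normr1.
have : \int[mu01 R]_(t in dycell R M 0) (cst 1 t + rademacher k.+1 t) =
       \int[mu01 R]_(t in dycell R M 0) (cst 1 t).
  rewrite /Rintegral; congr fine; rewrite integral_mkcond [RHS]integral_mkcond.
  transitivity (\int[mu01 R]_t (F t * (1 + rademacher k.+1 t))%:E)%E.
    apply: eq_integral => t _; rewrite /F indicE patchE.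
    by case: (t \in _); rewrite ?mul1r ?mul0r.
  rewrite H; apply: eq_integral => t _; rewrite /F indicE patchE.
  by case: (t \in _).
rewrite RintegralD//; last by apply: (@integrableS _ _ _ _ setT).
by move=> /eqP; rewrite -subr_eq0 addrC addKr => /eqP ->; rewrite mulr0.
Qed.

Lemma avg_series_rademacher (R : realType) (a : nat -> R) (M n : nat) :
  (M < n)%N ->
  avg (dycell R M 0) (fun t => series (fun k => a k * rademacher k t) n) =
  \sum_(0 <= k < M.+1) a k.
Proof.
move=> Mn.
have mE := @measurable_dycell R M 0.
have all_n m : avg (dycell R M 0) (fun t => series (fun k => a k * rademacher k t) m) =
    \sum_(0 <= k < m) a k * (k <= M)%:R.
  elim: m => [|m IH].
    rewrite big_geq// /avg (@eq_Rintegral _ _ _ _ _ (cst 0)).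
      by rewrite Rintegral_cst// mul0r mulr0.
    by move=> t _; rewrite /series/= big_geq.
  rewrite big_nat_recr//= -IH -avg_rademacher.
  rewrite (_ : (fun t => _) = (fun t => a m * rademacher m t +
      series (fun k => a k * rademacher k t) m)); last first.
    by apply/funext => t; rewrite /series/= big_nat_recr//= addrC.
  rewrite avg_lin//; first by rewrite addrC.
    exact/Linfty_integrable/rademacher_Linfty.
  exact: series_rademacher_integrable.
rewrite all_n (@big_cat_nat _ _ _ M.+1)//= [X in _ + X]big1_seq ?addr0; last first.
  by move=> k /andP[_]; rewrite mem_index_iota => /andP[Mk _]; rewrite leqNgt Mk mulr0.
rewrite big_nat_cond [RHS]big_nat_cond; apply: eq_bigr => k.
by rewrite ltnS => /andP[/andP[_ ->] _]; rewrite mulr1.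
Qed.

Lemma l2_tail_sqr (R : realType) (a : nat -> R) (v : R) (q : nat) : l2 a -> 0 < v ->
  exists p, (q <= p)%N /\ forall n, \sum_(p.+1 <= k < n) a k ^+ 2 <= v ^+ 2.
Proof.
move=> la v0; have [p hp] := l2_tail la (exprn_gt0 2 v0).
exists (p + q)%N; split; first exact: leq_addl.
move=> n; apply: le_trans (hp n); have [np|pn] := leqP n (p + q).+1.
  by rewrite big_geq// sumr_ge0// => k _; exact: sqr_ge0.
rewrite [leRHS](@big_cat_nat _ _ _ (p + q).+1)//= ?ltnS ?leq_addr ?(ltnW pn)//.
by rewrite lerDr sumr_ge0// => k _; exact: sqr_ge0.
Qed.

Lemma rademacher_sum_integrable (R : realType) (a : nat -> R) : l2 a ->
  (mu01 R).-integrable setT (EFin \o rademacher_sum a).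
Proof.
move=> la; have [p [_ hp]] := l2_tail_sqr 0 la (@ltr01 R).
pose S t := series (fun k => a k * rademacher k t) p.+1.
have mg := measurable_rademacher_sum a.
have IS := series_rademacher_integrable a p.+1.
have mS : measurable_fun setT S by case/integrableP: IS => /measurable_EFinP.
have ID : (mu01 R).-integrable setT (EFin \o (rademacher_sum a \- S)).
  apply: (integrable_bounded01 _ (rademacher_sum_L1 la ltr01 hp)).
    exact: measurable_funB.
  exact: ltry.
have -> : EFin \o rademacher_sum a = (EFin \o (rademacher_sum a \- S)) \+ (EFin \o S).
  by apply/funext => t /=; rewrite -EFinD subrK.
exact: integrableD.
Qed.

(** The average of a long partial sum is known exactly, and [rademacher_sum_L1]
    allows passing to the limit. *)
Lemma avg_rademacher_sum (R : realType) (a : nat -> R) (M : nat) : l2 a ->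
  avg (dycell R M 0) (rademacher_sum a) = \sum_(0 <= k < M.+1) a k.
Proof.
move=> la; have mE := @measurable_dycell R M 0.
have E0 : (0 < mu01 R (dycell R M 0))%E.
  by rewrite mu01_dycell0 lte_fin invr_gt0 exprn_gt0.
have Ig := rademacher_sum_integrable la.
have mg := measurable_rademacher_sum a.
apply/eqP; rewrite -subr_eq0 -normr_eq0 eq_le normr_ge0 andbT.
apply/ler_addgt0Pr => e e0; rewrite add0r.
pose v := e / ((2 * expR 2) * 2 ^+ M).
have c0 : 0 < (2 * expR 2) * 2 ^+ M :> R by rewrite !mulr_gt0 ?expR_gt0 ?exprn_gt0.
have v0 : 0 < v by rewrite divr_gt0.
have [p [Mp hp]] := l2_tail_sqr M la v0.
pose S t := series (fun k => a k * rademacher k t) p.+1.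
have IS := series_rademacher_integrable a p.+1.
have mS : measurable_fun setT S by case/integrableP: IS => /measurable_EFinP.
rewrite -(avg_series_rademacher a (Mp : (M < p.+1)%N)).
have -> : avg (dycell R M 0) (rademacher_sum a) - avg (dycell R M 0) S =
    avg (dycell R M 0) (rademacher_sum a \- S).
  rewrite (_ : rademacher_sum a \- S = (fun t => -1 * S t + rademacher_sum a t)).
    by rewrite avg_lin//; ring.
  by apply/funext => t /=; ring.
apply: avg_norm_le => //; last 2 first.
- exact: ltW.
- rewrite mu01_dycell0 -EFinM.
  have -> : e / 2 ^+ M = v * (2 * expR 2).
    by rewrite /v; field; rewrite expR_eq0 ?gt_eqF ?exprn_gt0 ?expR_gt0.
  apply: le_trans (rademacher_sum_L1 la v0 hp).
  apply: ge0_subset_integral => //.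
  by apply/measurable_EFinP; apply: measurableT_comp => //; exact: measurable_funB.
exact: (integrableB measurableT Ig IS).
Qed.

(** * From a function to a Rademacher sum and back *)

(** Up to a bounded function, f is small in the Orlicz norm; a small norm gives
    the tail bound at 2^(i - B - 1) by [orlicz_tail], and the bounded part is
    absorbed once i is large. *)
Lemma sum_carrier_small (R : realType) (f : R -> R) (B : nat) :
  sum_carrier (Linfty R) (Gspace R) f ->
  exists I, forall i, (I <= i)%N -> (tailm f (2 ^+ (i - B)) <= (dyad R i)%:E)%E.
Proof.
move=> Sf; have [mf _] := sum_carrier_integrable Sf.
move: Sf => [g [h [Lg Gh fgh]]].
have e0 : 0 < (2 ^+ B.+2)^-1 :> R by rewrite invr_gt0 exprn_gt0.
have [y [Ly mz [u zu ue]]] := Gspace_approx Gh e0.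
have [_ [Mg gM]] := (LinftyP g).1 Lg; have [_ [My yM]] := (LinftyP y).1 Ly.
pose K := Mg + My.
(* The bounded part of f is g + y, the small part is h - y. *)
have fz : {ae mu01 R, forall t, `|f t| <= K + `|(h \- y) t|}.
  apply: ae01_imp2 gM yM => t gt yt; rewrite fgh /=.
  rewrite (_ : g t + h t = g t + y t + (h t - y t)); last ring.
  apply: (le_trans (ler_normD _ _)); rewrite lerD2r.
  by apply: (le_trans (ler_normD _ _)); exact: lerD.
have [I0 KI] := pow2_lt_exists K; exists (I0 + B.+1)%N => i Ii.
pose s : R := 2 ^+ (i - B.+1).
have Ks : K + s <= 2 ^+ (i - B).
  have -> : (i - B = (i - B.+1).+1)%N by lia.
  rewrite exprS mulr_natl mulr2n lerD2r (le_trans (ltW KI))//.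
  by rewrite ler_eXn2l ?ltr1n//; lia.
apply: (le_trans (le_tailm mf Ks)).
apply: (le_trans (tailm_le_add s mf mz fz)).
apply: (orlicz_tail mz zu).
apply: (@le_trans _ _ (2 ^+ i.+1 / 2 ^+ B.+2)).
  by rewrite ler_wpM2l ?exprn_ge0// ltW.
rewrite ler_pdivrMr ?exprn_gt0// /s -exprD ler_eXn2l ?ltr1n//; lia.
Qed.

Lemma cst1_Gspace (R : realType) : carrier (Gspace R) (cst 1).
Proof.
have le1 : orlicz_le (cst (1 : R)) 2.
  split=> //; rewrite (eq_integral (cst (expsq (1 / 2))%:E)); last first.
    by move=> t _ /=; rewrite normr1.
  rewrite integral_cst// mu01T mule1 lee_fin /expsq.
  have := @expR_ge1Dx R (- (1 / 2) ^+ 2).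
  have : expR (- (1 / 2) ^+ 2) * expR ((1 / 2) ^+ 2) = 1 :> R.
    by rewrite -expRD addrC subrr expR0.
  have := expR_gt0 ((1 / 2) ^+ 2 : R).
  rewrite (_ : (1 / 2) ^+ 2 = 4^-1 :> R); last by field.
  by move: (expR _) (expR _) => x y; nra.
split; first by split=> //; exact: (orlicz_fin le1).1.
move=> e e0; exists (cst 1).
  by apply/LinftyP; split=> //; exists 1; apply: aeW => t /=; rewrite normr1.
have z0 : orlicz_le (cst (1 : R) \- cst 1) (e / 2).
  split; first by rewrite divr_gt0.
  rewrite (eq_integral (cst 0%E)) ?integral_cst ?mul0e//.
  by move=> t _ /=; rewrite subrr normr0 mul0r /expsq expr0n expR0 subrr.
have [z1 z2] := orlicz_fin z0.
split; first by split=> //; exact: measurable_funB.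
by apply: (le_lt_trans z2); lra.
Qed.

(** n i is the first exponent with tail at most [dyad R i], that is,
    2^(n i) is the rearrangement of f at [dyad R i] rounded up to a power of 2.
    The assumption f >= 1 makes the lower bound hold also when n i = 0. *)
Lemma level_exists (R : realType) (f : R -> R) :
  measurable_fun setT f -> sum_carrier (Linfty R) (Gspace R) f ->
  (forall t, 1 <= f t) ->
  exists n : nat -> nat, [/\ {homo n : i j / (i <= j)%N},
    forall B, exists I, forall i, (I <= i)%N -> (n i + B <= i)%N,
    forall i, (tailm f (2 ^+ n i) <= (dyad R i)%:E)%E &
    forall i, ((dyad R i.+1)%:E <= tailm f (2 ^+ n i / 2))%E].
Proof.
move=> mf Sf f1.
have ex i : exists m, (tailm f (2 ^+ m) <= (dyad R i)%:E)%E.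
  have [I hI] := sum_carrier_small 0 Sf; exists (I + i)%N.
  have := hI _ (leq_addr i I); rewrite subn0 => /le_trans; apply.
  by rewrite lee_fin dyad_le// leq_addl.
have min_le i m : (tailm f (2 ^+ m) <= (dyad R i)%:E)%E -> (ex_minn (ex i) <= m)%N.
  by case: ex_minnP => k _ + h; apply.
exists (fun i => ex_minn (ex i)); split.
- move=> i j ij; apply: min_le; case: ex_minnP => m hm _.
  by rewrite (le_trans hm)// lee_fin dyad_le.
- move=> B; have [I hI] := sum_carrier_small B Sf; exists (I + B)%N => i Ii.
  have Ii' : (I <= i)%N by lia.
  by have := min_le _ _ (hI _ Ii'); lia.
- by move=> i; case: ex_minnP.
- move=> i; case: ex_minnP => -[|m] hm min_m.
    rewrite (_ : tailm f _ = 1%E); first by rewrite lee_fin dyad_le1.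
    rewrite -(mu01T R); congr (mu01 R _); apply/seteqP; split=> // t _ /=.
    by rewrite expr0 (lt_le_trans _ (le_trans (f1 t) (ler_norm _)))//; lra.
  rewrite exprS mulrC mulKf ?pnatr_eq0//.
  have : ~~ (tailm f (2 ^+ m) <= (dyad R i)%:E)%E.
    by apply/negP => /min_m; rewrite ltnn.
  rewrite -ltNge => /ltW; apply: le_trans; rewrite lee_fin dyad_le//.
Qed.

(** The averages are taken over the level sets of f at 2^(n i) / 2, where f is
    at least 2^(n i) / 2, with i j an index that attains the envelope at j. *)
Lemma stepfn_pow2_of_function (R : realType) (X : fspace R) (f : R -> R)
    (n kappa : nat -> nat) :
  rearrangement_invariant X -> interpolation_space (Linfty R) (Gspace R) X ->
  carrier X f -> (forall t, 0 <= f t) ->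
  (forall i, ((dyad R i.+1)%:E <= tailm f (2 ^+ n i / 2))%E) ->
  (forall J, exists i, (kappa J + (i - J) <= n i)%N) ->
  carrier X (stepfn (fun j => 2 ^+ kappa j)).
Proof.
move=> riX intX Xf f0 fn /choice[i ik].
have mf := banach_measurable riX.1 Xf.
have [_ Xsum _] := intX; have [_ If] := sum_carrier_integrable (Xsum _ Xf).
pose E i := [set t : R | (2 ^+ n i / 2 < `|f t|)%R].
have mE k : measurable (E k) by exact: measurable_abs_gt.
have XT : carrier X (avgop E i f) by exact: avgop_carrier.
have X2T := banach_scale riX.1 2 XT.
apply: (ri_le_ae riX _ X2T _).1; first exact: measurable_stepfn.
apply: aeW => t; rewrite /avgop /stepfn; set j := cell t.
rewrite ger0_norm ?exprn_ge0//; apply: le_trans (ler_norm _).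
have avg_ge_n : 2 ^+ n (i j) / 2 <= avg (E (i j)) f.
  apply: avg_ge => //.
    by apply: lt_le_trans (fn _); rewrite lte_fin dyad_gt0.
  by move=> s; rewrite /E/= ger0_norm// => /ltW.
apply: (@le_trans _ _ (2 * (2^-1 ^+ (i j - j) * (2 ^+ n (i j) / 2)))); last first.
  by rewrite ler_wpM2l// ler_wpM2l//; case/andP: (half_pow_le1 R (i j - j)).
rewrite mulrCA (mulrC 2) divfK// exprVn mulrC ler_pdivlMr ?exprn_gt0//.
by rewrite -exprD ler_eXn2l ?ltr1n.
Qed.

Lemma rad_coef_tail (R : realType) (n kappa : nat -> nat) (j : nat) :
  (forall J i, (n i <= kappa J + (i - J))%N) ->
  (forall J, exists i, (kappa J + (i - J) <= n i)%N) ->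
  forall m, \sum_(4 ^ j <= k < m) rad_coef R kappa k ^+ 2 <=
    12 * (2 ^+ kappa j / 2 ^+ j) ^+ 2.
Proof.
move=> kge katt m.
apply: (@le_trans _ _ (\sum_(4 ^ j <= k < 4 ^ (m + j)) rad_coef R kappa k ^+ 2)).
  have [mj|jm] := leqP m (4 ^ j).
    by rewrite big_geq// sumr_ge0// => k _; exact: sqr_ge0.
  rewrite [leRHS](@big_cat_nat _ _ _ m)//=; last 2 first.
  - exact: ltnW.
  - by apply: ltnW; apply: (leq_trans (ltn_expl m (isT : (1 < 4)%N)));
      rewrite leq_pexp2l// leq_addr.
  by rewrite lerDl sumr_ge0// => k _; exact: sqr_ge0.
apply: (le_trans (rad_coef_sqr_sum R kappa j (m + j))).
have := peak_tail_sum kge katt R j (m + j).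
have : 0 <= \sum_(j <= i < m + j | peak kappa i) (2 ^+ kappa i / 2 ^+ i : R).
  by apply: sumr_ge0 => i _; rewrite divr_ge0 ?exprn_ge0.
set x := \sum_(_ <= _ < _ | _) _; set y := _ / _; nra.
Qed.

Lemma rad_coef_l2 (R : realType) (n kappa : nat -> nat) :
  (forall J i, (n i <= kappa J + (i - J))%N) ->
  (forall J, exists i, (kappa J + (i - J) <= n i)%N) ->
  l2 (@rad_coef R kappa).
Proof.
move=> kge katt; apply: nondecreasing_is_cvgn.
  by apply: nondecreasing_series => k _ _; exact: sqr_ge0.
exists (12 * (2 ^+ kappa 0 / 2 ^+ 0) ^+ 2) => _ [m _ <-].
rewrite /series/=; case: m => [|m].
  by rewrite big_geq// mulr_ge0// sqr_ge0.
rewrite big_ltn// {1}/rad_coef ltnn expr0n add0r.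
exact: (@rad_coef_tail R n kappa 0 kge katt m.+1).
Qed.

(** At level 26 2^(kappa j) the blocks up to j take at most 6 2^(kappa j) by
    [peak_head_sum], and the later ones exceed 20 2^(kappa j) with small
    probability, their coefficients having square sum at most
    12 (2^(kappa j) / 2^j)^2. *)
Lemma rademacher_sum_of_stepfn (R : realType) (X : fspace R)
    (n kappa : nat -> nat) :
  rearrangement_invariant X ->
  (forall J i, (n i <= kappa J + (i - J))%N) ->
  (forall J, exists i, (kappa J + (i - J) <= n i)%N) ->
  carrier X (stepfn (fun j => 2 ^+ kappa j)) ->
  carrier X (rademacher_sum (@rad_coef R kappa)).
Proof.
move=> riX kge katt Xk.
have la := @rad_coef_l2 R n kappa kge katt.
pose w j : R := 26 * 2 ^+ kappa j.
have Xw : carrier X (stepfn w) by apply: (banach_scale riX.1 26 Xk).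
apply: (stepfn_majorant riX (measurable_rademacher_sum _) _ _ _ Xw).
- by move=> j; rewrite mulr_ge0// exprn_ge0.
- move=> i j ij; rewrite ler_wpM2l// ler_eXn2l ?ltr1n//.
  exact: (envelope_homo kge katt).
move=> j; rewrite /w (_ : 26 * _ = 6 * 2 ^+ kappa j + 20 * 2 ^+ kappa j); last ring.
have k0 : 0 < 2 ^+ kappa j :> R by rewrite exprn_gt0.
have j0 : 0 < 2 ^+ j :> R by rewrite exprn_gt0.
have p4 : (4 ^ j.+1).-1.+1 = (4 ^ j.+1)%N by rewrite prednK// expn_gt0.
pose V : R := 12 * (2 ^+ kappa j / 2 ^+ j) ^+ 2.
have V0 : 0 < V by rewrite mulr_gt0// exprn_gt0// divr_gt0.
have s0 : 0 < 20 * 2 ^+ kappa j :> R by rewrite mulr_gt0.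
apply: (le_trans (rademacher_sum_tail (p := (4 ^ j.+1).-1) la s0 V0 _ _)).
- move=> m; rewrite p4; apply: (le_trans (@rad_coef_tail R n kappa j.+1 kge katt m)).
  rewrite ler_wpM2l// lerXn2r ?nnegrE ?divr_ge0 ?exprn_ge0//.
  rewrite (exprS _ j) invfM mulrA ler_pM2r ?invr_gt0// ler_pdivrMr// -exprSr.
  by rewrite ler_eXn2l ?ltr1n//; case/andP: (envelope_step kge katt j).
- rewrite p4 (eq_bigr (@rad_coef R kappa)); last first.
    by move=> k _; rewrite ger0_norm// rad_coef_ge0.
  rewrite rad_coef_sum; have := peak_head_sum kge katt R j; lra.
(* The constant 20 is chosen so that 20^2 / (8 * 12) = 25 / 6 is at least 4. *)
have -> : (20 * 2 ^+ kappa j) ^+ 2 / (8 * V) = 25 / 6 * (2 ^+ j) ^+ 2.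
  by rewrite /V; field; rewrite !gt_eqF.
rewrite lee_fin sqr_pow2.
apply: (@le_trans _ _ (2 * expR (- (4 ^ j.+1)%:R))).
  by rewrite ler_wpM2l// ler_expR lerN2 expnS natrM ler_wpM2r//; lra.
apply: (@le_trans _ _ (2 * 2^-1 ^+ (4 ^ j.+1))).
  by rewrite ler_wpM2l// expRN_nat_le.
by rewrite -p4 exprS mulrA mulfV ?pnatr_eq0// mul1r.
Qed.

(** The average of the sum over the interval where all Rademacher functions of
    the blocks up to i j equal 1 is at least 2^(kappa (i j)), for i j a peak
    that determines the envelope at j. *)
Lemma stepfn_pow2_of_rademacher_sum (R : realType) (X : fspace R)
    (n kappa : nat -> nat) :
  rearrangement_invariant X -> interpolation_space (Linfty R) (Gspace R) X ->
  {homo n : i j / (i <= j)%N} ->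
  (forall B, exists I, forall i, (I <= i)%N -> (n i + B <= i)%N) ->
  (forall J i, (n i <= kappa J + (i - J))%N) ->
  (forall J, exists i, (kappa J + (i - J) <= n i)%N) ->
  carrier X (rademacher_sum (@rad_coef R kappa)) ->
  carrier X (stepfn (fun j => 2 ^+ kappa j)).
Proof.
move=> riX intX nh nsmall kge katt Xg.
have la := @rad_coef_l2 R n kappa kge katt.
have : forall J, exists j, peak kappa j /\ kappa j = (kappa J + (j - J))%N.
  by move=> J; have [j ? ?] := peak_cover nh nsmall kge katt J; exists j.
move=> /choice[i iP].
pose E m := dycell R (4 ^ m.+1).-1 0.
have mE m : measurable (E m) by exact: measurable_dycell.
have XT : carrier X (avgop E i (rademacher_sum (@rad_coef R kappa))).
  apply: avgop_carrier => // m; rewrite /E mu01_dycell0 /dyad exprVn lexx//.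
apply: (ri_le_ae riX _ XT _).1; first exact: measurable_stepfn.
apply: aeW => t; rewrite /avgop /stepfn; set j := cell t.
rewrite ger0_norm ?exprn_ge0//; apply: le_trans (ler_norm _).
have [pj kj] := iP j.
rewrite avg_rademacher_sum// prednK ?expn_gt0// rad_coef_sum.
have : 2 ^+ kappa (i j) <= \sum_(0 <= l < (i j).+1 | peak kappa l) (2 ^+ kappa l : R).
  rewrite big_mkcond big_nat_recr//= pj lerDr sumr_ge0// => l _.
  by case: ifP => // _; rewrite exprn_ge0.
move=> h; apply: (@le_trans _ _ (2^-1 ^+ (i j - j) * 2 ^+ kappa (i j))).
  rewrite kj addnC exprD mulrA -exprMn mulVf ?pnatr_eq0// expr1n mul1r//.
have /andP[c0 _] := half_pow_le1 R (i j - j).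
by rewrite ler_wpM2l// (le_trans h)// ler_peMl ?ler1n// (le_trans _ h).
Qed.

Lemma carrier_sub_of_rademacher (R : realType) (X0 X1 : fspace R) :
  rearrangement_invariant X0 -> rearrangement_invariant X1 ->
  interpolation_space (Linfty R) (Gspace R) X0 ->
  interpolation_space (Linfty R) (Gspace R) X1 ->
  (forall a, l2 a -> carrier X0 (rademacher_sum a) -> carrier X1 (rademacher_sum a)) ->
  carrier X0 `<=` carrier X1.
Proof.
move=> ri0 ri1 int0 int1 rad01 f X0f.
have mf := banach_measurable ri0.1 X0f.
(* Adding 1 keeps all levels of the function positive. *)
pose f1 t := `|f t| + 1.
have X01 : carrier X0 (cst 1).
  have [+ _ _] := int0; apply; split; last exact: cst1_Gspace.
  by apply/LinftyP; split=> //; exists 1; apply: aeW => t /=; rewrite normr1.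
have X0f1 : carrier X0 f1 by apply: (banach_add ri0.1 (ri_abs ri0 X0f).1 X01).
have mf1 := banach_measurable ri0.1 X0f1.
have f1ge t : 1 <= f1 t by rewrite lerDr.
have [_ /(_ _ X0f1) Sf1 _] := int0.
have [n [nh nsmall ntail nE]] := level_exists mf1 Sf1 f1ge.
have [|kappa [kge katt]] := envelope_exists nh.
  have [I hI] := nsmall 0; exists I => i Ii.
  by have := hI _ Ii; rewrite addn0.
have Xk0 : carrier X0 (stepfn (fun j => 2 ^+ kappa j)).
  apply: (stepfn_pow2_of_function ri0 int0 X0f1 _ nE katt).
  by move=> t; rewrite (le_trans _ (f1ge t)).
have Xg1 := rad01 _ (@rad_coef_l2 R n kappa kge katt) (rademacher_sum_of_stepfn ri0 kge katt Xk0).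
have Xk1 := stepfn_pow2_of_rademacher_sum ri1 int1 nh nsmall kge katt Xg1.
have X1f1 : carrier X1 f1.
  have X2k := banach_scale ri1.1 2 Xk1.
  apply: (@stepfn_majorant R X1 (fun j => 2 * 2 ^+ kappa j) f1) => //.
  - move=> i j ij; rewrite ler_wpM2l// ler_eXn2l ?ltr1n//.
    exact: (envelope_homo kge katt).
  move=> j; apply: le_trans (ntail j.+1); apply: le_tailm => //.
  rewrite -exprS ler_eXn2l ?ltr1n//; have := kge j j.+1; lia.
apply: (ri_le_ae ri1 mf X1f1 _).1; apply: aeW => t.
by rewrite [leRHS]ger0_norm ?lerDl// (le_trans _ (f1ge t)).
Qed.

Lemma xnorm_in (R : realType) (X : fspace R) f : carrier X f -> xnorm X f = (fnorm X f)%:E.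
Proof. by move=> Xf; rewrite /xnorm; case: asboolP. Qed.

Lemma xnorm_out (R : realType) (X : fspace R) f : ~ carrier X f -> xnorm X f = +oo%E.
Proof. by move=> Xf; rewrite /xnorm; case: asboolP. Qed.

Theorem theorem3 (R : realType) (X0 X1 : fspace R)
    (ri0 : rearrangement_invariant X0) (ri1 : rearrangement_invariant X1)
    (int0 : interpolation_space (Linfty R) (Gspace R) X0)
    (int1 : interpolation_space (Linfty R) (Gspace R) X1)
    (hrad : asymp_on (@l2 R)
              (fun a => xnorm X0 (rademacher_sum a))
              (fun a => xnorm X1 (rademacher_sum a))) :
  carrier X0 = carrier X1 /\
  asymp_on (carrier X0) (xnorm X0) (xnorm X1).
Proof.
have [c [C [c0 C0 h]]] := hrad.
have h01 : carrier X0 `<=` carrier X1.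
  apply: carrier_sub_of_rademacher => // a la X0g; apply: contrapT => X1g.
  have /andP[+ _] := h _ la; rewrite (xnorm_out X1g) (xnorm_in X0g).
  by rewrite gt0_muley ?lte_fin// leye_eq.
have h10 : carrier X1 `<=` carrier X0.
  apply: carrier_sub_of_rademacher => // a la X1g; apply: contrapT => X0g.
  have /andP[_ +] := h _ la; rewrite (xnorm_out X0g) (xnorm_in X1g).
  by rewrite -EFinM leye_eq.
split; first exact/seteqP.
have [D D0 hD] := carrier_sub_bounded ri0 ri1 h01.
have [D' D'0 hD'] := carrier_sub_bounded ri1 ri0 h10.
exists D^-1, D'; split=> //; first by rewrite invr_gt0.
move=> f X0f; have X1f := h01 _ X0f.
rewrite (xnorm_in X0f) (xnorm_in X1f) -!EFinM !lee_fin ler_pdivrMl//.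
by rewrite hD// hD'.
Qed.
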